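(* Let $a=d=\tfrac14$, $b\neq0$ and $e=-b$. Then $\mathcal L=\mathcal L_{a,b,d,e}$ is a real Lie algebra of dimension $9$ with basis (where $\exp$ is the exponential function) \begin{align*} v_1&=b\exp(bt)x\,\partial_x+b\exp(bt)y\,\partial_y+\exp(bt)\partial_t+\tfrac12b\exp(bt)(4bx-1)u\,\partial_u,\\ v_2&=-b\exp(-bt)x\,\partial_x-b\exp(-bt)y\,\partial_y+\exp(-bt)\partial_t+\tfrac12b\exp(-bt)(4by+1)u\,\partial_u,\\ v_3&=\partial_t,\qquad v_4=\sqrt{xy}\,\partial_x-\sqrt{xy}\,\partial_y+2b\sqrt{xy}\,u\,\partial_u,\\ v_5&=\sqrt x\exp(\tfrac b2t)\partial_x+2b\sqrt x\exp(\tfrac b2t)u\,\partial_u,\qquad v_6=\sqrt x\exp(-\tfrac b2t)\partial_x,\\ v_7&=\sqrt y\exp(-\tfrac b2t)\partial_y-2b\sqrt y\exp(-\tfrac b2t)u\,\partial_u,\qquad v_8=\sqrt y\exp(\tfrac b2t)\partial_y,\qquad v_9=u\,\partial_u . \end{align*} The span $J$ of $v_4,\dots,v_9$ is a $6$-dimensional ideal of $\mathcal L$, $\mathcal L/J\cong\mathfrak{sl}_2$, and $\mathcal L\cong\mathfrak{sl}_2\ltimes J$ (semidirect product with ideal $J$).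
   Context: All Lie algebras are real. For real constants $a,b,d,e$ consider the PDE $$\Delta:=(a-bx)u_x+(d-ey)u_y+\tfrac x2u_{xx}+\tfrac y2u_{yy}+u_t=0$$ for $u=u(x,y,t)$, $x,y>0$, $t\in\mathbb R$. An infinitesimal symmetry of the PDE is a smooth vector field $v=\xi\partial_x+\gamma\partial_y+\tau\partial_t+\phi\partial_u$ on $\{(x,y,t,u):x>0,y>0,t\in\mathbb R,u\in\mathbb R\}$, with $\xi,\gamma,\tau,\phi$ functions of $(x,y,t,u)$, whose second prolongation $\mathrm{pr}^{(2)}v$ satisfies $\mathrm{pr}^{(2)}v(\Delta)=0$ at all points of the second jet space where $\Delta=0$. $\mathcal V_{a,b,d,e}$ is the Lie algebra of all infinitesimal symmetries, under the Lie bracket of vector fields. For every $v\in\mathcal V_{a,b,d,e}$ the coefficient $\phi$ is affine in $u$: $\phi=\lambda_v(x,y,t)u+\mu_v(x,y,t)$. Set $\mathcal L_{a,b,d,e}=\{v\in\mathcal V_{a,b,d,e}:\mu_v=0\}$. *)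

(* Defs.v *)
From Stdlib Require Import Reals Lra.
From Coquelicot Require Import Coquelicot.
From HB Require Import structures.
From mathcomp Require Import all_boot all_algebra.
From mathcomp Require Import boolp Rstruct.

Set Implicit Arguments.
Unset Strict Implicit.
Unset Printing Implicit Defensive.

Import GRing.Theory.
Local Open Scope ring_scope.

HB.mixin Record Lmodule_isLieAlgebra (K : fieldType) V of GRing.Lmodule K V := {
  lie : V -> V -> V;
  lie_linearl : forall z, linear (lie^~ z);
  lie_linearr : forall z, linear (lie z);
  liexx : forall x, lie x x = 0;
  lie_jacobi : forall x y z,
    lie x (lie y z) + lie y (lie z x) + lie z (lie x y) = 0
}.

#[short(type="lieAlgType")]
HB.structure Definition LieAlgebra (K : fieldType) :=
  {V of Lmodule_isLieAlgebra K V & GRing.Lmodule K V}.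

Notation "⁅ x , y ⁆" := (lie x y) (format "⁅ x ,  y ⁆").

Section LieTheory.
Variables (K : fieldType) (g : lieAlgType K).
Implicit Types x y z : g.

HB.instance Definition _ z :=
  GRing.isLinear.Build K g g _ (lie z) (lie_linearr z).

Definition lier z x := ⁅x, z⁆.
HB.instance Definition _ z :=
  GRing.isLinear.Build K g g _ (lier z) (lie_linearl z).

Lemma lieDr z x y : ⁅z, x + y⁆ = ⁅z, x⁆ + ⁅z, y⁆. Proof. exact: linearD. Qed.
Lemma lieNr z x : ⁅z, - x⁆ = - ⁅z, x⁆. Proof. exact: linearN. Qed.
Lemma lieBr z x y : ⁅z, x - y⁆ = ⁅z, x⁆ - ⁅z, y⁆. Proof. exact: linearB. Qed.
Lemma lieZr a z x : ⁅z, a *: x⁆ = a *: ⁅z, x⁆.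
Proof. by rewrite linearZ. Qed.
Lemma lieDl z x y : ⁅x + y, z⁆ = ⁅x, z⁆ + ⁅y, z⁆.
Proof. exact: (linearD (lier z)). Qed.
Lemma lieNl z x : ⁅- x, z⁆ = - ⁅x, z⁆. Proof. exact: (linearN (lier z)). Qed.
Lemma lieBl z x y : ⁅x - y, z⁆ = ⁅x, z⁆ - ⁅y, z⁆.
Proof. exact: (linearB (lier z)). Qed.
Lemma lieZl a z x : ⁅a *: x, z⁆ = a *: ⁅x, z⁆.
Proof. exact: (linearZ_LR (lier z)). Qed.

Lemma lieC x y : ⁅x, y⁆ = - ⁅y, x⁆.
Proof.
apply/eqP; rewrite -addr_eq0.
have /eqP := liexx (x + y).
by rewrite lieDl !lieDr !liexx add0r addr0.
Qed.

End LieTheory.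

Definition lie_isom (K : fieldType) (g h : lieAlgType K) : Prop :=
  exists f : {linear g -> h},
    bijective f /\ {morph f : x y / ⁅x, y⁆ >-> ⁅x, y⁆}.

Record lieSubalg (K : fieldType) (g : lieAlgType K) := LieSubalg {
  lie_subalg_mem :> {pred g};
  lie_subalg_submod : submod_closed lie_subalg_mem;
  lie_subalg_lie :
    {in lie_subalg_mem &, forall x y, ⁅x, y⁆ \in lie_subalg_mem}
}.

(* One-sided stability suffices, since the bracket is antisymmetric. *)
Record lieIdeal (K : fieldType) (g : lieAlgType K) := LieIdeal {
  lie_ideal_mem :> {pred g};
  lie_ideal_submod : submod_closed lie_ideal_mem;
  lie_ideal_lie : forall x, {in lie_ideal_mem, forall y, ⁅x, y⁆ \in lie_ideal_mem}
}.

Section SubAlgebra.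
Variables (K : fieldType) (g : lieAlgType K) (S : lieSubalg g).

HB.instance Definition _ :=
  GRing.isSubmodClosed.Build K g (lie_subalg_mem S) (lie_subalg_submod S).

Definition subalg_type : Type := {x : g | x \in lie_subalg_mem S}.
HB.instance Definition _ := SubChoice.on subalg_type.
HB.instance Definition _ := [SubChoice_isSubLmodule of subalg_type by <:].

Definition sub_lie (x y : subalg_type) : subalg_type :=
  Sub ⁅val x, val y⁆ (lie_subalg_lie (valP x) (valP y)).

Fact sub_lie_linearl z : linear (sub_lie^~ z).
Proof.
by move=> a x y; apply/val_inj; rewrite /= lieDl lieZl.
Qed.
Fact sub_lie_linearr z : linear (sub_lie z).
Proof. by move=> a x y; apply/val_inj; rewrite /= lieDr lieZr. Qed.
Fact sub_liexx x : sub_lie x x = 0.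
Proof. by apply/val_inj; rewrite /= liexx. Qed.
Fact sub_lie_jacobi x y z :
  sub_lie x (sub_lie y z) + sub_lie y (sub_lie z x) + sub_lie z (sub_lie x y) = 0.
Proof. by apply/val_inj; rewrite /= lie_jacobi. Qed.

HB.instance Definition _ := Lmodule_isLieAlgebra.Build K subalg_type
  sub_lie_linearl sub_lie_linearr sub_liexx sub_lie_jacobi.

End SubAlgebra.

Coercion subalg_lieAlgType (K : fieldType) (g : lieAlgType K)
  (S : lieSubalg g) : lieAlgType K := subalg_type S.

Coercion ideal_subalg (K : fieldType) (g : lieAlgType K) (I : lieIdeal g) :
  lieSubalg g :=
  LieSubalg (lie_ideal_submod I) (fun x y _ yI => lie_ideal_lie x yI).

Section Quotient.
Variables (K : fieldType) (g : lieAlgType K) (I : lieIdeal g).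
Local Open Scope quotient_scope.

HB.instance Definition _ :=
  GRing.isSubmodClosed.Build K g (lie_ideal_mem I) (lie_ideal_submod I).

(* The additive quotient of the library, equipped below with the scaling and the
   bracket of cosets. *)
Definition lie_quot : Type := Quotient.quot (lie_ideal_mem I).
HB.instance Definition _ := GRing.Zmodule.on lie_quot.
HB.instance Definition _ := EqQuotient.on lie_quot.

Lemma lie_quotP (x y : g) : x - y \in I -> \pi_lie_quot x = \pi_lie_quot y.
Proof. by move=> xyI; apply/eqP; rewrite -Quotient.idealrBE. Qed.

Lemma lie_quot_repr (x : g) : repr (\pi_lie_quot x) - x \in I.
Proof. by rewrite Quotient.idealrBE reprK. Qed.

Lemma lie_quotD (x y : g) :
  \pi_lie_quot (x + y) = \pi_lie_quot x + \pi_lie_quot y.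
Proof. exact: Quotient.pi_add. Qed.

Lemma lie_quot0 : \pi_lie_quot 0 = 0.
Proof. by apply: (addIr (\pi_lie_quot 0)); rewrite -lie_quotD !add0r. Qed.

Definition lie_quot_scale (a : K) := lift_op1 lie_quot ( *:%R a).

Lemma lie_quotZ a (x : g) :
  lie_quot_scale a (\pi_lie_quot x) = \pi_lie_quot (a *: x).
Proof.
rewrite /lie_quot_scale; unlock.
apply: lie_quotP; rewrite -scalerBr.
by apply: rpredZ; exact: lie_quot_repr.
Qed.

Fact lie_quot_scaleA a b q :
  lie_quot_scale a (lie_quot_scale b q) = lie_quot_scale (a * b) q.
Proof. by rewrite -[q]reprK !lie_quotZ scalerA. Qed.
Fact lie_quot_scale1 : left_id 1 lie_quot_scale.
Proof. by move=> q; rewrite -[q]reprK lie_quotZ scale1r. Qed.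
Fact lie_quot_scaleDr : right_distributive lie_quot_scale +%R.
Proof.
move=> a p q; rewrite -[p]reprK -[q]reprK.
by rewrite -lie_quotD !lie_quotZ -lie_quotD scalerDr.
Qed.
Fact lie_quot_scaleDl q : {morph lie_quot_scale^~ q : a b / a + b}.
Proof.
move=> a b; rewrite -[q]reprK.
by rewrite !lie_quotZ -lie_quotD scalerDl.
Qed.

HB.instance Definition _ := GRing.Zmodule_isLmodule.Build K lie_quot
  lie_quot_scaleA lie_quot_scale1 lie_quot_scaleDr lie_quot_scaleDl.

Definition lie_quot_lie := lift_op2 lie_quot (@lie K g).

Lemma lie_quot_lieE (x y : g) :
  lie_quot_lie (\pi_lie_quot x) (\pi_lie_quot y) = \pi_lie_quot ⁅x, y⁆.
Proof.
rewrite /lie_quot_lie; unlock; apply: lie_quotP; set x' := repr _; set y' := repr _.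
have -> : ⁅x', y'⁆ - ⁅x, y⁆ = ⁅x', y' - y⁆ - ⁅y, x' - x⁆.
  by rewrite !lieBr [⁅y, x'⁆]lieC [⁅y, x⁆]lieC opprD !opprK addrA subrK.
by apply: rpredB; apply: lie_ideal_lie; exact: lie_quot_repr.
Qed.

Let piZ a (x : g) : a *: \pi_lie_quot x = \pi_lie_quot (a *: x).
Proof. exact: lie_quotZ. Qed.

Fact lie_quot_linearl r : linear (lie_quot_lie^~ r).
Proof.
move=> a p q; rewrite -[p]reprK -[q]reprK -[r]reprK.
by rewrite piZ -lie_quotD !lie_quot_lieE piZ -lie_quotD lieDl lieZl.
Qed.
Fact lie_quot_linearr r : linear (lie_quot_lie r).
Proof.
move=> a p q; rewrite -[p]reprK -[q]reprK -[r]reprK.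
by rewrite piZ -lie_quotD !lie_quot_lieE piZ -lie_quotD lieDr lieZr.
Qed.
Fact lie_quot_liexx q : lie_quot_lie q q = 0.
Proof.
by rewrite -[q]reprK lie_quot_lieE liexx lie_quot0.
Qed.
Fact lie_quot_jacobi p q r :
  lie_quot_lie p (lie_quot_lie q r) + lie_quot_lie q (lie_quot_lie r p)
    + lie_quot_lie r (lie_quot_lie p q) = 0.
Proof.
rewrite -[p]reprK -[q]reprK -[r]reprK !lie_quot_lieE -!lie_quotD lie_jacobi.
exact: lie_quot0.
Qed.

HB.instance Definition _ := Lmodule_isLieAlgebra.Build K lie_quot
  lie_quot_linearl lie_quot_linearr lie_quot_liexx lie_quot_jacobi.

End Quotient.

(* An action of g on h by derivations, i.e. a Lie morphism from g to Der(h). *)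
Record lieAction (K : fieldType) (g h : lieAlgType K) := LieAction {
  lie_act :> g -> h -> h;
  lie_act_linearl : forall y, linear (lie_act^~ y);
  lie_act_linearr : forall x, linear (lie_act x);
  lie_act_derivation : forall x y z,
    lie_act x ⁅y, z⁆ = ⁅lie_act x y, z⁆ + ⁅y, lie_act x z⁆;
  lie_act_lie : forall x x' y,
    lie_act ⁅x, x'⁆ y = lie_act x (lie_act x' y) - lie_act x' (lie_act x y)
}.

Section Semidirect.
Variables (K : fieldType) (g h : lieAlgType K).

Definition semidirect of lieAction g h : Type := (g * h)%type.

Variable rho : lieAction g h.

HB.instance Definition _ x :=
  GRing.isLinear.Build K h h _ (rho x) (lie_act_linearr rho x).

HB.instance Definition _ := GRing.Lmodule.on (semidirect rho).

Definition semidirect_lie (p q : semidirect rho) : semidirect rho :=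
  (⁅p.1, q.1⁆, ⁅p.2, q.2⁆ + rho p.1 q.2 - rho q.1 p.2).

Fact semidirect_linearl r : linear (semidirect_lie^~ r).
Proof.
move=> a p q; congr pair => /=; first by rewrite lieDl lieZl.
rewrite lieDl lieZl lie_act_linearl linearP /= !scalerDr scalerN opprD.
by rewrite [X in X + _ = _]addrACA [LHS]addrACA.
Qed.
Fact semidirect_linearr r : linear (semidirect_lie r).
Proof.
move=> a p q; congr pair => /=; first by rewrite lieDr lieZr.
rewrite lieDr lieZr lie_act_linearl linearP /= !scalerDr scalerN opprD.
by rewrite [X in X + _ = _]addrACA [LHS]addrACA.
Qed.
Fact semidirect_liexx p : semidirect_lie p p = 0.
Proof. by congr pair => /=; rewrite !liexx // add0r subrr. Qed.
Fact semidirect_jacobi p q r :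
  semidirect_lie p (semidirect_lie q r) + semidirect_lie q (semidirect_lie r p)
    + semidirect_lie r (semidirect_lie p q) = 0.
Proof.
case: p q r => [x u] [y v] [z w]; congr pair => /=; first exact: lie_jacobi.
rewrite !(lieDr, lieNr, linearD, linearN) /= !lie_act_derivation !lie_act_lie.
rewrite (lieC (rho x v)) (lieC (rho y w)) (lieC (rho z u)) !opprB !addrA.
rewrite [LHS](ACl ((1*10*19)*(2*13)*(23*3)*(20*4)*(5*12)*(6*27)*(17*7)*(8*25)
  *(15*9)*(11*22)*(14*21)*(26*16)*(24*18)))/=.
by rewrite !subrr !addr0 lie_jacobi.
Qed.

HB.instance Definition _ := Lmodule_isLieAlgebra.Build K (semidirect rho)
  semidirect_linearl semidirect_linearr semidirect_liexx semidirect_jacobi.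

End Semidirect.

Section SpecialLinear.
Variables (K : fieldType) (n : nat).

Definition gl : Type := 'M[K]_n.
HB.instance Definition _ := GRing.Lmodule.on gl.

Definition gl_lie (A B : gl) : gl := A *m B - B *m A.

Fact gl_linearl C : linear (gl_lie^~ C).
Proof.
move=> a A B; rewrite /gl_lie mulmxDl mulmxDr -scalemxAl -scalemxAr.
by rewrite scalerBr opprD addrACA.
Qed.
Fact gl_linearr C : linear (gl_lie C).
Proof.
move=> a A B; rewrite /gl_lie mulmxDl mulmxDr -scalemxAl -scalemxAr.
by rewrite scalerBr opprD addrACA.
Qed.
Fact gl_liexx A : gl_lie A A = 0.
Proof. exact: subrr. Qed.
Fact gl_jacobi A B C :
  gl_lie A (gl_lie B C) + gl_lie B (gl_lie C A) + gl_lie C (gl_lie A B) = 0.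
Proof.
rewrite /gl_lie !mulmxBl !mulmxBr !mulmxA !opprB !addrA.
rewrite [LHS](ACl ((1*12)*(7*2)*(9*8)*(3*10)*(5*4)*(11*6)))/=.
by rewrite !subrr !addr0.
Qed.

HB.instance Definition _ := Lmodule_isLieAlgebra.Build K gl
  gl_linearl gl_linearr gl_liexx gl_jacobi.

Definition sl_mem : {pred gl} := fun A => \tr A == 0.

Fact sl_submod : submod_closed sl_mem.
Proof.
split=> [|a A B]; rewrite !unfold_in ?mxtrace0 // => /eqP trA /eqP trB.
by rewrite mxtraceD mxtraceZ trA trB mulr0 addr0.
Qed.
Fact sl_lie : {in sl_mem &, forall A B, ⁅A, B⁆ \in sl_mem}.
Proof.
by move=> A B _ _; rewrite unfold_in [X in \tr X]/(gl_lie A B) raddfB /= mxtrace_mulC subrr.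
Qed.
Definition sl : lieSubalg gl := LieSubalg sl_submod sl_lie.

End SpecialLinear.

Section Bases.
Variables (K : fieldType) (V : lmodType K) (n : nat).

Definition lin_span (v : 'I_n -> V) (w : V) : Prop :=
  exists c : 'I_n -> K, w = \sum_i c i *: v i.

Definition lin_indep (v : 'I_n -> V) : Prop :=
  forall c : 'I_n -> K, \sum_i c i *: v i = 0 -> forall i, c i = 0.

Definition lin_basis (v : 'I_n -> V) : Prop :=
  lin_indep v /\ forall w, lin_span v w.

End Bases.

Definition has_dim (K : fieldType) (V : lmodType K) (n : nat) : Prop :=
  exists v : 'I_n -> V, lin_basis v.

Local Close Scope ring_scope.
Local Open Scope R_scope.

(* Independent variables x, y, t; coordinates (x, y, t, u), with u = Dep;
   coordinates on the second jet space, where J1 i stands for u_i and Jxx, ...,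
   Jtt for the second derivatives of u. *)
Inductive ivar := vx | vy | vt.
Inductive var := Ind of ivar | Dep.
Inductive jvar :=
  | J0 of var | J1 of ivar | Jxx | Jxy | Jxt | Jyy | Jyt | Jtt.

Definition var_eq_dec : comparable var.
Proof. rewrite /comparable /decidable; do 2 decide equality. Defined.
Definition jvar_eq_dec : comparable jvar.
Proof. rewrite /comparable /decidable; do 3 decide equality. Defined.
HB.instance Definition _ := hasDecEq.Build var (compareP var_eq_dec).
HB.instance Definition _ := hasDecEq.Build jvar (compareP jvar_eq_dec).

Definition upd (C : eqType) (p : C -> R) (c : C) (s : R) : C -> R :=
  fun c' => if c' == c then s else p c'.

(* Partial derivative along the coordinate c. *)
Definition pd (C : eqType) (c : C) (f : (C -> R) -> R) (p : C -> R) : R :=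
  Derive (fun s => f (upd p c s)) (p c).

Definition pt := var -> R.

Definition dom (p : pt) : Prop := 0 < p (Ind vx) /\ 0 < p (Ind vy).

(* The topology on pt is that of the sup norm. As dom is open, Ck k f only
   depends on the restriction of f to dom. *)
Fixpoint Ck (k : nat) (f : pt -> R) : Prop :=
  (forall p, dom p -> continuous f p) /\
  match k with
  | 0%N => True
  | S k' => forall c,
      (forall p, dom p -> ex_derive (fun s => f (upd p c s)) (p c)) /\
      Ck k' (pd c f)
  end.

Definition smooth (f : pt -> R) : Prop := forall k, Ck k f.

Lemma upd_id (C : eqType) (p : C -> R) c : upd p c (p c) = p.
Proof. by apply: funext => c'; rewrite /upd; case: eqP => [->|]. Qed.

Lemma upd_upd (C : eqType) (p : C -> R) c s t : upd (upd p c s) c t = upd p c t.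
Proof. by apply: funext => c'; rewrite /upd; case: eqP. Qed.

Lemma upd_eq (C : eqType) (p : C -> R) c s : upd p c s c = s.
Proof. by rewrite /upd eqxx. Qed.

Lemma upd_neq (C : eqType) (p : C -> R) c d s : d != c -> upd p c s d = p d.
Proof. by rewrite /upd => /negPf ->. Qed.

Lemma updC (C : eqType) (p : C -> R) c d s t :
  d != c -> upd (upd p c s) d t = upd (upd p d t) c s.
Proof.
move=> dc; apply: funext => e; rewrite /upd.
by case: (eqVneq e d) => // ->; rewrite (negPf dc).
Qed.

Lemma dom_open p : dom p -> locally p dom.
Proof.
move=> [px py].
have m0 : 0 < Rmin (p (Ind vx)) (p (Ind vy)) by apply: Rmin_pos.
exists (mkposreal _ m0) => q pq.
have := pq (Ind vx); have := pq (Ind vy).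
rewrite /ball /= /AbsRing_ball /abs /minus /plus /Hierarchy.opp /=.
move=> /Rabs_def2 [_ hy] /Rabs_def2 [_ hx].
have := Rmin_l (p (Ind vx)) (p (Ind vy)).
have := Rmin_r (p (Ind vx)) (p (Ind vy)).
by split; lra.
Qed.

Lemma upd_ball (p : pt) (c : var) s (e : posreal) :
  ball (p c) e s -> ball p e (upd p c s).
Proof.
move=> ps c'; rewrite /upd; case: eqP => [->//|_]; exact: ball_center.
Qed.

Lemma upd_cont (p : pt) (c : var) :
  filterlim (upd p c) (locally (p c)) (locally p).
Proof.
move=> P [e Pe]; exists e => s ps; apply: Pe; exact: upd_ball.
Qed.

Lemma dom_upd (p : pt) (c : var) : dom p -> locally (p c) (fun s => dom (upd p c s)).
Proof. by move=> dp; apply: upd_cont; exact: dom_open. Qed.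

Definition eq_dom (f g : pt -> R) := forall p, dom p -> f p = g p.

Lemma pd_ext f g c : eq_dom f g -> eq_dom (pd c f) (pd c g).
Proof.
move=> fg p dp; apply: Derive_ext_loc.
by apply: filter_imp (dom_upd c dp) => s; exact: fg.
Qed.

Lemma Ck_ext k f g : eq_dom f g -> Ck k f -> Ck k g.
Proof.
elim: k f g => [|k IH] f g fg /= [cf df].
  split=> // p dp; apply: (continuous_ext_loc _ f) (cf _ dp).
  by apply: filter_imp (dom_open dp) => q; exact: fg.
split=> [p dp|c].
  apply: (continuous_ext_loc _ f) (cf _ dp).
  by apply: filter_imp (dom_open dp) => q; exact: fg.
split=> [p dp|].
  apply: ex_derive_ext_loc (proj1 (df c) _ dp).
  by apply: filter_imp (dom_upd c dp) => s; exact: fg.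
exact: IH (pd_ext c fg) (proj2 (df c)).
Qed.

Lemma Ck_cont k f p : dom p -> Ck k f -> continuous f p.
Proof. by case: k => [|k] dp [cf _]; apply: cf. Qed.

Lemma Ck_ex k f p (c : var) : dom p -> Ck k.+1 f ->
  ex_derive (fun s => f (upd p c s)) (p c).
Proof. by move=> dp [_ df]; apply: (proj1 (df c)). Qed.

Lemma Ck_pd k f c : Ck k.+1 f -> Ck k (pd c f).
Proof. by move=> [_ df]; exact: (proj2 (df c)). Qed.

Lemma CkW k f : Ck k.+1 f -> Ck k f.
Proof.
elim: k f => [|k IH] f [cf df]; split=> // c.
split; first exact: (proj1 (df c)).
exact: IH (proj2 (df c)).
Qed.

Lemma pd_add f g c : Ck 1 f -> Ck 1 g ->
  eq_dom (pd c (fun p => f p + g p)) (fun p => pd c f p + pd c g p).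
Proof.
by move=> Cf Cg p dp; rewrite /pd Derive_plus //; first [exact: Ck_ex dp Cf | exact: Ck_ex dp Cg].
Qed.

Lemma pd_opp f c : eq_dom (pd c (fun p => - f p)) (fun p => - pd c f p).
Proof. by move=> p dp; rewrite /pd Derive_opp. Qed.

Lemma pd_mul f g c : Ck 1 f -> Ck 1 g ->
  eq_dom (pd c (fun p => f p * g p)) (fun p => pd c f p * g p + f p * pd c g p).
Proof.
move=> Cf Cg p dp; rewrite /pd Derive_mult ?upd_id //; first [exact: Ck_ex dp Cf | exact: Ck_ex dp Cg].
Qed.

Lemma Ck1 k f : Ck k.+1 f -> Ck 1 f.
Proof. by elim: k => // k IH /CkW. Qed.

Lemma Ck_add k f g : Ck k f -> Ck k g -> Ck k (fun p => f p + g p).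
Proof.
elim: k f g => [|k IH] f g Cf Cg /=; split.
- move=> p dp; apply: (continuous_plus f g); first [exact: Ck_cont dp Cf | exact: Ck_cont dp Cg].
- by [].
- move=> p dp; apply: (continuous_plus f g); first [exact: Ck_cont dp Cf | exact: Ck_cont dp Cg].
- move=> c; split=> [p dp|].
    by apply: (ex_derive_plus (V := R_NormedModule)); first [exact: Ck_ex dp Cf | exact: Ck_ex dp Cg].
  apply: (@Ck_ext _ (fun p => pd c f p + pd c g p)).
    by move=> p dp; exact: esym (pd_add c (Ck1 Cf) (Ck1 Cg) dp).
  by apply: IH; exact: Ck_pd.
Qed.

Lemma Ck_opp k f : Ck k f -> Ck k (fun p => - f p).
Proof.
elim: k f => [|k IH] f Cf /=; split.
- move=> p dp; apply: (continuous_opp f); first [exact: Ck_cont dp Cf | exact: Ck_cont dp Cg].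
- by [].
- move=> p dp; apply: (continuous_opp f); first [exact: Ck_cont dp Cf | exact: Ck_cont dp Cg].
- move=> c; split=> [p dp|].
    by apply: (ex_derive_opp (V := R_NormedModule)); first [exact: Ck_ex dp Cf | exact: Ck_ex dp Cg].
  apply: (@Ck_ext _ (fun p => - pd c f p)).
    by move=> p dp; exact: esym (pd_opp f c dp).
  by apply: IH; exact: Ck_pd.
Qed.

Lemma Ck_mul k f g : Ck k f -> Ck k g -> Ck k (fun p => f p * g p).
Proof.
elim: k f g => [|k IH] f g Cf Cg /=; split.
- move=> p dp; apply: (continuous_mult (K := R_AbsRing) f g); first [exact: Ck_cont dp Cf | exact: Ck_cont dp Cg].
- by [].
- move=> p dp; apply: (continuous_mult (K := R_AbsRing) f g); first [exact: Ck_cont dp Cf | exact: Ck_cont dp Cg].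
- move=> c; split=> [p dp|].
    by apply: ex_derive_mult; first [exact: Ck_ex dp Cf | exact: Ck_ex dp Cg].
  apply: (@Ck_ext _ (fun p => pd c f p * g p + f p * pd c g p)).
    by move=> p dp; exact: esym (pd_mul c (Ck1 Cf) (Ck1 Cg) dp).
  by apply: Ck_add; apply: IH; solve [exact: Ck_pd | exact: CkW].
Qed.

Lemma Ck_const k (a : R) : Ck k (fun=> a).
Proof.
elim: k a => [|k IH] a /=; split.
- by move=> p _; exact: continuous_const.
- by [].
- by move=> p _; exact: continuous_const.
- move=> c; split=> [p _|]; first exact: ex_derive_const.
  apply: (@Ck_ext _ (fun=> 0)) (IH 0) => p _.
  by rewrite /pd Derive_const.
Qed.

Lemma pd_comm f c d : Ck 2 f -> eq_dom (pd c (pd d f)) (pd d (pd c f)).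
Proof.
move=> Cf p dp; case: (eqVneq c d) => [->//|cd].
have dc : d != c by rewrite eq_sym.
pose F a b := f (upd (upd p c a) d b).
have E1 a b : upd (upd (upd p c a) d b) c = fun r => upd (upd p c r) d b.
  by apply: funext => r; rewrite (updC _ _ _ dc) upd_upd (updC _ _ _ cd).
have E2 a b : upd (upd (upd p c a) d b) d = fun r => upd (upd p c a) d r.
  by apply: funext => r; rewrite upd_upd.
have Ec a b : upd (upd p c a) d b c = a by rewrite upd_neq // upd_eq.
have pdF a b : pd d f (upd (upd p c a) d b) = Derive (fun r => F a r) b.
  by rewrite /pd E2 upd_eq.
have pcF a b : pd c f (upd (upd p c a) d b) = Derive (fun r => F r b) a.
  by rewrite /pd E1 Ec.
have pcdF a b : pd c (pd d f) (upd (upd p c a) d b) =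
    Derive (fun r => Derive (fun z => F r z) b) a.
  rewrite {1}/pd E1 Ec; apply: Derive_ext => r; exact: pdF.
have pdcF a b : pd d (pd c f) (upd (upd p c a) d b) =
    Derive (fun r => Derive (fun z => F z r) a) b.
  rewrite {1}/pd E2 upd_eq; apply: Derive_ext => r; exact: pcF.
have pE : upd (upd p c (p c)) d (p d) = p by rewrite !upd_id.
have ballF a b (e : posreal) : Rabs (a - p c) < e -> Rabs (b - p d) < e ->
    ball p e (upd (upd p c a) d b).
  move=> ha hb e'; rewrite /upd; case: eqP => [->//|_].
  by case: eqP => [->//|_]; exact: ball_center.
have cont2 (h : pt -> R) : continuous h p ->
    continuity_2d_pt (fun a b => h (upd (upd p c a) d b)) (p c) (p d).
  move=> ch e.
  have /ch [r hr] : locally (h p) (ball (h p) e) by exists e.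
  exists r => a b ha hb; rewrite pE; exact: hr (ballF a b r ha hb).
rewrite -{1}pE pcdF -[in RHS]pE pdcF; apply: (Schwarz F).
- have [r hr] := dom_open dp; exists r => a b ha hb.
  have dq := hr _ (ballF a b r ha hb).
  have exF g e : Ck 1 g ->
      ex_derive (fun s => g (upd (upd (upd p c a) d b) e s))
        (upd (upd p c a) d b e) by move=> Cg; exact: (Ck_ex (k := 0) _ dq).
  have C1 := CkW Cf; have C1c := Ck_pd c Cf; have C1d := Ck_pd d Cf.
  split; [|split; [|split]].
  + by have := exF _ c C1; rewrite E1 Ec.
  + by have := exF _ d C1; rewrite E2 upd_eq.
  + have := exF _ c C1d; rewrite E1 Ec; apply: ex_derive_ext => s; exact: pdF.
  + have := exF _ d C1c; rewrite E2 upd_eq; apply: ex_derive_ext => s; exact: pcF.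
- apply: (continuity_2d_pt_ext (fun a b => pd c (pd d f) (upd (upd p c a) d b))).
    by move=> a b; exact: pcdF.
  apply: cont2; exact: (Ck_cont (k := 0) dp) (Ck_pd c (Ck_pd d Cf)).
- apply: (continuity_2d_pt_ext (fun a b => pd d (pd c f) (upd (upd p c a) d b))).
    by move=> a b; exact: pdcF.
  apply: cont2; exact: (Ck_cont (k := 0) dp) (Ck_pd d (Ck_pd c Cf)).
Qed.

Definition sumv (F : var -> R) : R :=
  F (Ind vx) + F (Ind vy) + F (Ind vt) + F Dep.

(* The smooth vector fields sum_c (vcoef c) d/dc on dom. Coefficients are total
   functions; they are set to 0 outside dom so that Leibniz equality of vector
   fields is equality on dom (see vfieldP). *)
Record vfield := VField {
  vcoef : var -> pt -> R;
  vcoef_smooth : forall c, smooth (vcoef c);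
  vcoef_off : forall c p, ~ dom p -> vcoef c p = 0
}.

HB.instance Definition _ := gen_eqMixin vfield.
HB.instance Definition _ := gen_choiceMixin vfield.

Lemma vfieldP v w :
  (forall c p, dom p -> vcoef v c p = vcoef w c p) -> v = w.
Proof.
case: v w => [v vs v0] [w ws w0] /= vw.
have E : v = w.
  apply: funext => c; apply: funext => p.
  by case: (pselect (dom p)) => dp; [exact: vw | rewrite v0 ?w0].
subst w; congr VField; exact: Prop_irrelevance.
Qed.

Definition vf_zero : vfield.
Proof. by exists (fun _ _ => 0) => [c k|//]; exact: Ck_const. Defined.

Definition vf_opp (v : vfield) : vfield.
Proof.
exists (fun c p => - vcoef v c p) => [c k|c p dp].
  exact/Ck_opp/vcoef_smooth.
by rewrite vcoef_off // Ropp_0.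
Defined.

Definition vf_add (v w : vfield) : vfield.
Proof.
exists (fun c p => vcoef v c p + vcoef w c p) => [c k|c p dp].
  by apply: Ck_add; exact: vcoef_smooth.
by rewrite !vcoef_off // Rplus_0_l.
Defined.

Definition vf_scale (a : R) (v : vfield) : vfield.
Proof.
exists (fun c p => a * vcoef v c p) => [c k|c p dp].
  by apply: (Ck_mul (Ck_const k a)); exact: vcoef_smooth.
by rewrite vcoef_off // Rmult_0_r.
Defined.

Fact vf_addA : associative vf_add.
Proof. by move=> u v w; apply: vfieldP => c p _ /=; ring. Qed.
Fact vf_addC : commutative vf_add.
Proof. by move=> u v; apply: vfieldP => c p _ /=; ring. Qed.
Fact vf_add0 : left_id vf_zero vf_add.
Proof. by move=> u; apply: vfieldP => c p _ /=; ring. Qed.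
Fact vf_addN : left_inverse vf_zero vf_opp vf_add.
Proof. by move=> u; apply: vfieldP => c p _ /=; ring. Qed.
HB.instance Definition _ :=
  GRing.isZmodule.Build vfield vf_addA vf_addC vf_add0 vf_addN.

Fact vf_scaleA a b v : vf_scale a (vf_scale b v) = vf_scale (a * b) v.
Proof. by apply: vfieldP => c p _ /=; ring. Qed.
Fact vf_scale1 : left_id 1 vf_scale.
Proof. by move=> v; apply: vfieldP => c p _ /=; ring. Qed.
Fact vf_scaleDr : right_distributive vf_scale vf_add.
Proof. by move=> a u v; apply: vfieldP => c p _ /=; ring. Qed.
Fact vf_scaleDl v a b : vf_scale (a + b) v = vf_add (vf_scale a v) (vf_scale b v).
Proof. by apply: vfieldP => c p _ /=; ring. Qed.
HB.instance Definition _ := GRing.Zmodule_isLmodule.Build R vfield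
  vf_scaleA vf_scale1 vf_scaleDr vf_scaleDl.

Definition vf_bracket_coef (v w : vfield) (c : var) (p : pt) : R :=
  sumv (fun j => vcoef v j p * pd j (vcoef w c) p
                 - vcoef w j p * pd j (vcoef v c) p).

Lemma Ck_sumv k (F : var -> pt -> R) :
  (forall j, Ck k (F j)) -> Ck k (fun p => sumv (fun j => F j p)).
Proof.
by move=> CF; rewrite /sumv; do 3 (apply: Ck_add; last exact: CF); exact: CF.
Qed.

Lemma vcoef_Ck v c k : Ck k (vcoef v c). Proof. exact: vcoef_smooth. Qed.
#[local] Hint Resolve vcoef_Ck : core.

Lemma vf_pd_Ck v c d k : Ck k (pd d (vcoef v c)).
Proof. exact: Ck_pd. Qed.
#[local] Hint Resolve vf_pd_Ck : core.

Definition vf_bracket (v w : vfield) : vfield.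
Proof.
exists (vf_bracket_coef v w) => [c k|c p dp].
  apply: (Ck_sumv (F := fun j p => vcoef v j p * pd j (vcoef w c) p
                 - vcoef w j p * pd j (vcoef v c) p)) => j.
  by apply: Ck_add; [|apply: Ck_opp]; apply: Ck_mul.
by rewrite /vf_bracket_coef /sumv !vcoef_off //; ring.
Defined.

Lemma pd_bracket v w i c p : dom p ->
  pd i (vf_bracket_coef v w c) p =
  sumv (fun j => pd i (vcoef v j) p * pd j (vcoef w c) p
                 + vcoef v j p * pd i (pd j (vcoef w c)) p
                 - (pd i (vcoef w j) p * pd j (vcoef v c) p
                    + vcoef w j p * pd i (pd j (vcoef v c)) p)).
Proof.
move=> dp.
pose F j q := vcoef v j q * pd j (vcoef w c) q - vcoef w j q * pd j (vcoef v c) q.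
have CF j : Ck 1 (F j).
  by apply: Ck_add; [|apply: Ck_opp]; apply: Ck_mul.
have E j : pd i (F j) p = pd i (vcoef v j) p * pd j (vcoef w c) p
                 + vcoef v j p * pd i (pd j (vcoef w c)) p
                 - (pd i (vcoef w j) p * pd j (vcoef v c) p
                    + vcoef w j p * pd i (pd j (vcoef v c)) p).
  rewrite /F pd_add //; try (by apply: Ck_mul); last first.
    by apply: Ck_opp; apply: Ck_mul.
  by rewrite pd_opp // !pd_mul.
rewrite /vf_bracket_coef -/F /sumv.
have C2 := Ck_add (CF (Ind vx)) (CF (Ind vy)).
have C3 := Ck_add C2 (CF (Ind vt)).
by rewrite (pd_add i C3 (CF Dep) dp) (pd_add i C2 (CF (Ind vt)) dp)
  (pd_add i (CF (Ind vx)) (CF (Ind vy)) dp) !E.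
Qed.

Fact vf_linearl w : GRing.linear_for *:%R (vf_bracket^~ w).
Proof.
move=> a u v; apply: vfieldP => c p dp.
change (vf_bracket_coef (vf_add (vf_scale a u) v) w c p =
  a * vf_bracket_coef u w c p + vf_bracket_coef v w c p).
rewrite /vf_bracket_coef /=.
have E j : pd j (fun q => a * vcoef u c q + vcoef v c q) p =
    a * pd j (vcoef u c) p + pd j (vcoef v c) p.
  rewrite pd_add //; last by apply: Ck_mul => //; exact: Ck_const.
  by rewrite /pd Derive_scal.
by rewrite /sumv !E; ring.
Qed.

Fact vf_liexx v : vf_bracket v v = 0%R.
Proof. by apply: vfieldP => c p dp /=; rewrite /vf_bracket_coef /sumv; ring. Qed.

Lemma vf_bracketC u v : vf_bracket u v = vf_opp (vf_bracket v u).
Proof. by apply: vfieldP => c p dp /=; rewrite /vf_bracket_coef /sumv; ring. Qed.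

Fact vf_linearr w : GRing.linear_for *:%R (vf_bracket w).
Proof.
move=> a u v; rewrite (vf_bracketC w) (vf_linearl w) (vf_bracketC w u)
  (vf_bracketC w v).
by apply: vfieldP => c p dp; change ( - (a * vf_bracket_coef u w c p + vf_bracket_coef v w c p)
   = a * (- vf_bracket_coef u w c p) + - vf_bracket_coef v w c p); ring.
Qed.

Fact vf_jacobi u v w :
  (vf_bracket u (vf_bracket v w) + vf_bracket v (vf_bracket w u)
    + vf_bracket w (vf_bracket u v) = 0)%R.
Proof.
apply: vfieldP => c p dp.
change (vf_bracket_coef u (vf_bracket v w) c p + vf_bracket_coef v (vf_bracket w u) c p
  + vf_bracket_coef w (vf_bracket u v) c p = 0).
have E r s t : vf_bracket_coef r (vf_bracket s t) c p =
    sumv (fun j => vcoef r j p * pd j (vf_bracket_coef s t c) p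
                   - vf_bracket_coef s t j p * pd j (vcoef r c) p) by [].
rewrite !E /sumv !pd_bracket // /vf_bracket_coef /sumv.
have S z i j : pd i (pd j (vcoef z c)) p = pd j (pd i (vcoef z c)) p.
  exact: pd_comm.
rewrite !(S _ (Ind vy) (Ind vx)) !(S _ (Ind vt) (Ind vx)) !(S _ (Ind vt) (Ind vy)).
rewrite !(S _ Dep (Ind _)).
ring.
Qed.

HB.instance Definition _ := Lmodule_isLieAlgebra.Build R vfield
  vf_linearl vf_linearr vf_liexx vf_jacobi.

Definition jet := jvar -> R.

Definition base (z : jet) : pt := fun c => z (J0 c).

Definition lift (f : pt -> R) : jet -> R := fun z => f (base z).

Definition u2 (i j : ivar) : jvar :=
  match i, j with
  | vx, vx => Jxx | vy, vy => Jyy | vt, vt => Jtt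
  | vx, vy | vy, vx => Jxy
  | vx, vt | vt, vx => Jxt
  | vy, vt | vt, vy => Jyt
  end.

Definition sumi (F : ivar -> R) : R := F vx + F vy + F vt.

(* Total derivative D_i of a function on the first jet space, i.e. of an F
   that does not depend on the second-order coordinates. *)
Definition totD (i : ivar) (F : jet -> R) (z : jet) : R :=
  pd (J0 (Ind i)) F z + z (J1 i) * pd (J0 Dep) F z
  + sumi (fun k => z (u2 i k) * pd (J1 k) F z).

(* phi^i = D_i phi - sum_k u_k D_i xi^k *)
Definition prolong1 (v : vfield) (i : ivar) (z : jet) : R :=
  totD i (lift (vcoef v Dep)) z
  - sumi (fun k => z (J1 k) * totD i (lift (vcoef v (Ind k))) z).

(* phi^ij = D_j phi^i - sum_k u_ik D_j xi^k *)
Definition prolong2 (v : vfield) (i j : ivar) (z : jet) : R :=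
  totD j (prolong1 v i) z
  - sumi (fun k => z (u2 i k) * totD j (lift (vcoef v (Ind k))) z).

Definition pr2 (v : vfield) (F : jet -> R) (z : jet) : R :=
  sumv (fun c => vcoef v c (base z) * pd (J0 c) F z)
  + sumi (fun i => prolong1 v i z * pd (J1 i) F z)
  + prolong2 v vx vx z * pd Jxx F z + prolong2 v vx vy z * pd Jxy F z
  + prolong2 v vx vt z * pd Jxt F z + prolong2 v vy vy z * pd Jyy F z
  + prolong2 v vy vt z * pd Jyt F z + prolong2 v vt vt z * pd Jtt F z.

Definition Delta (a b d e : R) (z : jet) : R :=
  let x := z (J0 (Ind vx)) in let y := z (J0 (Ind vy)) in
  (a - b * x) * z (J1 vx) + (d - e * y) * z (J1 vy)
  + x / 2 * z Jxx + y / 2 * z Jyy + z (J1 vt).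

Definition inf_symmetry (a b d e : R) (v : vfield) : Prop :=
  forall z : jet, dom (base z) -> Delta a b d e z = 0 ->
    pr2 v (Delta a b d e) z = 0.

(* The symmetries with phi = lambda u + mu and mu = 0. *)
Definition in_L (a b d e : R) (v : vfield) : Prop :=
  inf_symmetry a b d e v /\
  exists lam mu : R -> R -> R -> R,
    (forall p, dom p ->
       let: (x, y, t, u) := (p (Ind vx), p (Ind vy), p (Ind vt), p Dep) in
       vcoef v Dep p = lam x y t * u + mu x y t) /\
    (forall x y t, 0 < x -> 0 < y -> mu x y t = 0).

Definition vcomp (xi gamma tau phi : R) (c : var) : R :=
  match c with Ind vx => xi | Ind vy => gamma | Ind vt => tau | Dep => phi end.

(* The index i : 'I_9 stands for v_(i+1). *)
Definition gen_coef (b : R) (i : 'I_9) (c : var) (p : pt) : R :=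
  let x := p (Ind vx) in let y := p (Ind vy) in
  let t := p (Ind vt) in let u := p Dep in
  nth (fun=> 0)
    [:: vcomp (b * exp (b * t) * x) (b * exp (b * t) * y) (exp (b * t))
          (1 / 2 * b * exp (b * t) * (4 * b * x - 1) * u);
        vcomp (- b * exp (- b * t) * x) (- b * exp (- b * t) * y)
          (exp (- b * t)) (1 / 2 * b * exp (- b * t) * (4 * b * y + 1) * u);
        vcomp 0 0 1 0;
        vcomp (sqrt (x * y)) (- sqrt (x * y)) 0 (2 * b * sqrt (x * y) * u);
        vcomp (sqrt x * exp (b / 2 * t)) 0 0
          (2 * b * sqrt x * exp (b / 2 * t) * u);
        vcomp (sqrt x * exp (- b / 2 * t)) 0 0 0;
        vcomp 0 (sqrt y * exp (- b / 2 * t)) 0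
          (- 2 * b * sqrt y * exp (- b / 2 * t) * u);
        vcomp 0 (sqrt y * exp (b / 2 * t)) 0 0;
        vcomp 0 0 0 u]
    i c.

(* Main.v *)
From Stdlib Require Import Reals Lra.
From Coquelicot Require Import Coquelicot.
From HB Require Import structures.
From mathcomp Require Import all_boot all_algebra.
From mathcomp Require Import boolp Rstruct.
Require Import Defs.

(** In the coordinates s = sqrt x, r = sqrt y the equation is a two-dimensional heat
    equation with linear drift.  Comparing the coefficients of the jet variables in
    pr2 v (Delta) = 0 shows that tau depends on t only and that the spatial part of a
    symmetry is a time-dependent dilation plus a rotation of rate k(t) plus a
    translation.  The coefficients of u_x and u_y then give the gradient of the
    multiplier lambda = phi / u; the equality of its mixed derivatives forces k to be
    constant, and the remaining equation is a polynomial in s and r whose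
    coefficients are the ODEs tau''' = b^2 tau', al'' = (b/2)^2 al,
    be'' = (b/2)^2 be and c' = - tau'' / 2 (al, be the translations, c the constant
    term of lambda).  Their solutions are the combinations of the nine generators.

    Since the symmetries with mu = 0 are exactly these combinations, closure under
    the bracket is read off the structure constants.  The tau-component vanishes
    precisely on J, and v_1, v_2, v_3 span a copy of sl_2 complementary to J. *)

Set Implicit Arguments.
Unset Strict Implicit.
Unset Printing Implicit Defensive.

Import GRing.Theory.

(** * Complements of an ideal in a Lie algebra *)

Section LieComplement.
Local Open Scope ring_scope.
Local Open Scope quotient_scope.
Variables (K : fieldType) (g h : lieAlgType K) (J : lieIdeal h).
Variable sigma : {linear g -> h}.
Hypothesis sigma_lie : {morph sigma : x y / ⁅x, y⁆ >-> ⁅x, y⁆}.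
Hypothesis sigma_cap : forall x, sigma x \in J -> x = 0.
Hypothesis sigma_sum : forall y, exists x, y - sigma x \in J.

(** The adjoint action of the image of [sigma], restricted to the ideal; it is the action that glues
    [g] and [J] back to [h]. *)
Definition complement_act (x : g) (j : J) : J :=
  Sub ⁅sigma x, val j⁆ (lie_ideal_lie (sigma x) (valP j)).

Fact complement_act_linearl j : linear (complement_act^~ j).
Proof. by move=> k x y; apply/val_inj; rewrite /= linearP lieDl lieZl. Qed.

Fact complement_act_linearr x : linear (complement_act x).
Proof. by move=> k i j; apply/val_inj; rewrite /= lieDr lieZr. Qed.

(** Jacobi identity in [h], rewritten by antisymmetry; the same identity together with [sigma_lie]
    gives [complement_act_lie]. *)
Fact complement_act_derivation x i j :
  complement_act x ⁅i, j⁆ = ⁅complement_act x i, j⁆ + ⁅i, complement_act x j⁆.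
Proof.
apply/val_inj => /=; have := lie_jacobi (sigma x) (val i) (val j).
rewrite (lieC (val j) (sigma x)) lieNr (lieC (val j)) -addrA -opprD => /subr0_eq.
by rewrite addrC.
Qed.

Fact complement_act_lie x y j :
  complement_act ⁅x, y⁆ j =
  complement_act x (complement_act y j) - complement_act y (complement_act x j).
Proof.
apply/val_inj => /=; rewrite sigma_lie.
have := lie_jacobi (sigma x) (sigma y) (val j).
rewrite (lieC (val j) (sigma x)) lieNr (lieC (val j)).
by move=> /subr0_eq.
Qed.

Definition complement_action : lieAction g J :=
  LieAction complement_act_linearl complement_act_linearr
    complement_act_derivation complement_act_lie.

Definition complement_sum (p : semidirect complement_action) : h :=
  sigma p.1 + val p.2.

Fact complement_sum_linear : linear complement_sum.
Proof.
by move=> k p q; rewrite /complement_sum /= linearP scalerDr addrACA.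
Qed.

HB.instance Definition _ :=
  GRing.isLinear.Build K (semidirect complement_action) h _ complement_sum
    complement_sum_linear.

Lemma complement_sum_lie p q :
  complement_sum ⁅p, q⁆ = ⁅complement_sum p, complement_sum q⁆.
Proof.
case: p q => [x i] [y j]; rewrite /complement_sum /= sigma_lie lieDl !lieDr.
by rewrite (lieC (val i) (sigma y)) -!addrA; congr (_ + _);
  rewrite addrC -!addrA; congr (_ + _); rewrite addrC.
Qed.

(** The sum is direct: [sigma_sum] provides a component in [g] and [sigma_cap] makes it unique, so
    the component chosen by [cid] belongs to every decomposition. *)
Lemma complement_sum_bij : bijective complement_sum.
Proof.
pose pr y := sval (cid (sigma_sum y)).
have prP y : y - sigma (pr y) \in J by exact: svalP (cid (sigma_sum y)).
exists (fun y => (pr y, Sub (y - sigma (pr y)) (prP y))) => [[x j]|y].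
  have E : pr (complement_sum (x, j)) = x.
    apply/esym/eqP; rewrite -subr_eq0; apply/eqP/sigma_cap; rewrite linearB.
    have := prP (complement_sum (x, j)); set z := pr _.
    rewrite /complement_sum /= addrAC => zJ.
    rewrite -(addrK (val j) (_ - _)).
    by apply: (rpredB (S := J)) => //; exact: valP.
  congr pair => //; apply/val_inj.
  by rewrite /= E /complement_sum /= addrAC subrr add0r.
by rewrite /complement_sum /= addrC subrK.
Qed.

End LieComplement.

(** * Isomorphisms and the quotient by a complemented ideal *)

Section LieIsom.
Local Open Scope ring_scope.
Variables (K : fieldType) (g h : lieAlgType K).

Lemma lie_isom_sym : lie_isom g h -> lie_isom h g.
Proof.
move=> [f [[f' fK f'K] f_lie]].
have f'_lin : linear f' by move=> k x y; apply: (can_inj fK); rewrite linearP !f'K.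
pose f'L := GRing.isLinear.Build K h g _ f' f'_lin.
pose F : {linear h -> g} := HB.pack f' f'L.
exists F; split; first by exists f.
by move=> x y; apply: (can_inj fK); rewrite f_lie !f'K.
Qed.

End LieIsom.

Section LieComplementQuot.
Local Open Scope ring_scope.
Local Open Scope quotient_scope.
Variables (K : fieldType) (g h : lieAlgType K) (J : lieIdeal h).
Variable sigma : {linear g -> h}.
Hypothesis sigma_lie : {morph sigma : x y / ⁅x, y⁆ >-> ⁅x, y⁆}.
Hypothesis sigma_cap : forall x, sigma x \in J -> x = 0.
Hypothesis sigma_sum : forall y, exists x, y - sigma x \in J.

(** [sigma] followed by the projection is injective by [sigma_cap] and onto by [sigma_sum]. The map
    is built into the quotient and then inverted, so linearity and brackets are checked only on
    [sigma]. *)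
Lemma complement_quot : lie_isom (lie_quot J) g.
Proof.
apply: lie_isom_sym.
pose f x := \pi_(lie_quot J) (sigma x) : lie_quot J.
have f_lin : linear f.
  move=> k x y; rewrite /f linearP lie_quotD; congr (_ + _).
  by rewrite -lie_quotZ.
pose fL := GRing.isLinear.Build K g (lie_quot J) _ f f_lin.
pose F : {linear g -> lie_quot J} := HB.pack f fL.
exists F; split; last first.
  by move=> x y; rewrite /= /f sigma_lie -lie_quot_lieE.
pose f' (q : lie_quot J) := sval (cid (sigma_sum (repr q))).
have f'K : cancel f' f.
  move=> q; rewrite /f -[RHS]reprK; apply/esym/lie_quotP.
  exact: svalP (cid (sigma_sum (repr q))).
exists f' => // x; apply/eqP; rewrite -subr_eq0; apply/eqP/sigma_cap.
rewrite linearB Quotient.idealrBE; apply/eqP; exact: f'K.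
Qed.

End LieComplementQuot.

Local Open Scope R_scope.

(** * Partial derivatives and prolongations *)

Section PartialDerivatives.
Variable C : eqType.
Implicit Types (c : C) (f g : (C -> R) -> R) (p : C -> R).

(** [pd] is total and says nothing of differentiability; [is_pd] carries it, so the rules below
    compose without separate existence conditions. *)
Definition is_pd c f p (l : R) := is_derive (fun s => f (upd p c s)) (p c) l.

Lemma is_pdE c f p l : is_pd c f p l -> pd c f p = l.
Proof. exact: is_derive_unique. Qed.

Lemma is_pd_const c (a : R) p : is_pd c (fun=> a) p 0.
Proof. exact: is_derive_const. Qed.

Lemma is_pd_add c f g p l m :
  is_pd c f p l -> is_pd c g p m -> is_pd c (fun q => f q + g q) p (l + m).
Proof. exact: is_derive_plus. Qed.

Lemma is_pd_opp c f p l : is_pd c f p l -> is_pd c (fun q => - f q) p (- l).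
Proof. exact: is_derive_opp. Qed.

Lemma is_pd_sub c f g p l m :
  is_pd c f p l -> is_pd c g p m -> is_pd c (fun q => f q - g q) p (l - m).
Proof. exact: is_derive_minus. Qed.

Lemma is_pd_mul c f g p l m :
  is_pd c f p l -> is_pd c g p m ->
  is_pd c (fun q => f q * g q) p (l * g p + f p * m).
Proof.
move=> fl gm; rewrite /is_pd.
have := is_derive_mult _ _ _ _ _ fl gm Rmult_comm; by rewrite /= upd_id.
Qed.

Lemma is_pd_coord c p : is_pd c (fun q => q c) p 1.
Proof.
apply: (is_derive_ext (fun s => s)); last exact: is_derive_id.
by move=> s; rewrite upd_eq.
Qed.

Lemma is_pd_coord_neq c d p : d != c -> is_pd c (fun q => q d) p 0.
Proof.
move=> dc; apply: (is_derive_ext (fun _ => p d)); last exact: is_derive_const.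
by move=> s; rewrite upd_neq.
Qed.

Lemma is_pd_comp c (h : R -> R) f p l m :
  is_derive h (f p) m -> is_pd c f p l -> is_pd c (fun q => h (f q)) p (m * l).
Proof.
move=> hm fl; rewrite /is_pd Rmult_comm.
apply: (is_derive_comp h (fun s => f (upd p c s))) => //.
by rewrite upd_id.
Qed.

End PartialDerivatives.

Lemma is_pd_Ck (c : var) f p : dom p -> Ck 1 f -> is_pd c f p (pd c f p).
Proof. by move=> dp Cf; apply: Derive_correct; exact: Ck_ex dp Cf. Qed.

(** * Total derivatives and prolongation formulas *)

Section Jets.
Implicit Types (F G : jet -> R) (z : jet).

Definition jdiff F z := forall c, ex_derive (fun s => F (upd z c s)) (z c).

Lemma base_upd z c s : base (upd z (J0 c) s) = upd (base z) c s.
Proof.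
apply: funext => d; rewrite /base /upd.
by case: (eqVneq d c) => [->|/eqP dc]; [rewrite eqxx | case: eqP => // -[]].
Qed.

Lemma base_upd_neq z j s : (forall c, j <> J0 c) -> base (upd z j s) = base z.
Proof.
by move=> jc; apply: funext => d; rewrite /base /upd; case: eqP => // /esym/jc.
Qed.

Lemma pd_lift c f z : pd (J0 c) (lift f) z = pd c f (base z).
Proof. by apply: Derive_ext => s; rewrite /lift base_upd. Qed.

Lemma pd_lift0 j f z : (forall c, j <> J0 c) -> pd j (lift f) z = 0.
Proof.
move=> jc; rewrite /pd (Derive_ext _ (fun=> lift f z)) ?Derive_const // => s.
by rewrite /lift base_upd_neq.
Qed.

Lemma totD_lift i f z :
  totD i (lift f) z = pd (Ind i) f (base z) + z (J1 i) * pd Dep f (base z).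
Proof. by rewrite /totD !pd_lift /sumi !pd_lift0 //; ring. Qed.

Lemma totD_coord i k z : totD i (fun w => w (J1 k)) z = z (u2 i k).
Proof.
have E d : J1 k != d -> pd d (fun w : jet => w (J1 k)) z = 0.
  by move=> kd; apply: is_pdE; exact: is_pd_coord_neq.
rewrite /totD !E // /sumi.
have D : pd (J1 k) (fun w : jet => w (J1 k)) z = 1.
  by apply: is_pdE; exact: is_pd_coord.
by case: k E D => E D; rewrite ?D ?E //; ring.
Qed.

Lemma jdiff_is_pd F z c : jdiff F z -> is_pd c F z (pd c F z).
Proof. by move=> dF; exact: Derive_correct. Qed.

Lemma totD_add i F G z : jdiff F z -> jdiff G z ->
  totD i (fun w => F w + G w) z = totD i F z + totD i G z.
Proof.
move=> dF dG.
have E c := is_pdE (is_pd_add (jdiff_is_pd c dF) (jdiff_is_pd c dG)).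
by rewrite /totD /sumi !E; ring.
Qed.

Lemma totD_sub i F G z : jdiff F z -> jdiff G z ->
  totD i (fun w => F w - G w) z = totD i F z - totD i G z.
Proof.
move=> dF dG.
have E c := is_pdE (is_pd_sub (jdiff_is_pd c dF) (jdiff_is_pd c dG)).
by rewrite /totD /sumi !E; ring.
Qed.

Lemma totD_mul i F G z : jdiff F z -> jdiff G z ->
  totD i (fun w => F w * G w) z = totD i F z * G z + F z * totD i G z.
Proof.
move=> dF dG.
have E c := is_pdE (is_pd_mul (jdiff_is_pd c dF) (jdiff_is_pd c dG)).
by rewrite /totD /sumi !E; ring.
Qed.

Lemma jdiff_add F G z : jdiff F z -> jdiff G z -> jdiff (fun w => F w + G w) z.
Proof.
by move=> dF dG c; eexists; apply: is_pd_add; exact: jdiff_is_pd.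
Qed.

Lemma jdiff_sub F G z : jdiff F z -> jdiff G z -> jdiff (fun w => F w - G w) z.
Proof.
by move=> dF dG c; eexists; apply: is_pd_sub; exact: jdiff_is_pd.
Qed.

Lemma jdiff_mul F G z : jdiff F z -> jdiff G z -> jdiff (fun w => F w * G w) z.
Proof.
by move=> dF dG c; eexists; apply: is_pd_mul; exact: jdiff_is_pd.
Qed.

Lemma jdiff_coord j z : jdiff (fun w => w j) z.
Proof.
move=> c; case: (eqVneq j c) => [->|jc]; eexists.
  exact: is_pd_coord.
exact: is_pd_coord_neq jc.
Qed.

Lemma jdiff_lift f z : dom (base z) -> Ck 1 f -> jdiff (lift f) z.
Proof.
move=> dz Cf j.
have : (exists c, j = J0 c) \/ forall c, j <> J0 c.
  by case: j => [c|k||||||]; [left; exists c|right..].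
case=> [[c ->]|jc].
  apply: (ex_derive_ext (fun s => f (upd (base z) c s))).
    by move=> s; rewrite /lift base_upd.
  exact: Ck_ex dz Cf.
apply: (ex_derive_ext (fun=> lift f z)); last exact: ex_derive_const.
by move=> s; rewrite /lift base_upd_neq.
Qed.

(** The total derivative D_i of a function on the base; [D2] is D_i applied twice, with the mixed
    partial derivatives identified. *)
Definition D1 i f (z : jet) := pd (Ind i) f (base z) + z (J1 i) * pd Dep f (base z).

Lemma totD_liftE i f : totD i (lift f) =
  fun z => lift (pd (Ind i) f) z + z (J1 i) * lift (pd Dep f) z.
Proof. by apply: funext => z; rewrite totD_lift. Qed.

(** Spelled out in sums and products of lifts and jet coordinates, so that the rules for [totD] can
    differentiate it once more. *)
Lemma prolong1E v i : prolong1 v i = fun z =>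
  lift (pd (Ind i) (vcoef v Dep)) z + z (J1 i) * lift (pd Dep (vcoef v Dep)) z
  - (z (J1 vx) * (lift (pd (Ind i) (vcoef v (Ind vx))) z
                  + z (J1 i) * lift (pd Dep (vcoef v (Ind vx))) z)
     + z (J1 vy) * (lift (pd (Ind i) (vcoef v (Ind vy))) z
                  + z (J1 i) * lift (pd Dep (vcoef v (Ind vy))) z)
     + z (J1 vt) * (lift (pd (Ind i) (vcoef v (Ind vt))) z
                  + z (J1 i) * lift (pd Dep (vcoef v (Ind vt))) z)).
Proof. by apply: funext => z; rewrite /prolong1 /sumi !totD_liftE. Qed.

Definition D2 i f (z : jet) :=
  pd (Ind i) (pd (Ind i) f) (base z) + 2 * z (J1 i) * pd (Ind i) (pd Dep f) (base z)
  + z (J1 i) * z (J1 i) * pd Dep (pd Dep f) (base z) + z (u2 i i) * pd Dep f (base z).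

(** One term u_ik D_i xi^k comes from differentiating u_k in phi^i, the other from the definition,
    whence the factor 2. The diagonal case is the relevant one, as [Delta] has no mixed second
    derivative. *)
Lemma prolong2E v i z : dom (base z) ->
  prolong2 v i i z =
  D2 i (vcoef v Dep) z
  - sumi (fun k => z (J1 k) * D2 i (vcoef v (Ind k)) z
                   + 2 * z (u2 i k) * D1 i (vcoef v (Ind k)) z).
Proof.
move=> dz; rewrite /prolong2 /sumi !totD_lift prolong1E.
have L c d : jdiff (lift (pd d (vcoef v c))) z by apply: jdiff_lift => //; exact: vf_pd_Ck.
have S c k : pd Dep (pd (Ind k) (vcoef v c)) (base z) =
    pd (Ind k) (pd Dep (vcoef v c)) (base z).
  by apply: pd_comm => //; exact: vcoef_Ck.
have U k : u2 k i = u2 i k by case: i k => -[].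
by rewrite !(totD_add, totD_sub, totD_mul, totD_coord, totD_lift) /D1 /D2 ?S;
  first (rewrite /lift; ring);
  repeat first [apply: jdiff_add | apply: jdiff_sub | apply: jdiff_mul
               | apply: jdiff_coord | apply: L].
Qed.

End Jets.

(** The factors are the partial derivatives of [Delta], which vanish along t, u and all second-order
    coordinates except u_xx and u_yy. *)
Definition pr2_Delta (a b d e : R) (v : vfield) (z : jet) : R :=
  let x := z (J0 (Ind vx)) in let y := z (J0 (Ind vy)) in
  vcoef v (Ind vx) (base z) * (- b * z (J1 vx) + 1 / 2 * z Jxx)
  + vcoef v (Ind vy) (base z) * (- e * z (J1 vy) + 1 / 2 * z Jyy)
  + (a - b * x) * prolong1 v vx z + (d - e * y) * prolong1 v vy z
  + prolong1 v vt z
  + x / 2 * prolong2 v vx vx z + y / 2 * prolong2 v vy vy z.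

Ltac pd_Delta z :=
  apply: is_derive_unique; rewrite /upd /eq_op /=; auto_derive; [done | field].

Lemma pr2_DeltaE a b d e v z : pr2 v (Delta a b d e) z = pr2_Delta a b d e v z.
Proof.
pose p j := pd j (Delta a b d e) z.
have Ex : p (J0 (Ind vx)) = - b * z (J1 vx) + 1 / 2 * z Jxx.
  rewrite /p /pd /Delta; pd_Delta z.
have Ey : p (J0 (Ind vy)) = - e * z (J1 vy) + 1 / 2 * z Jyy.
  rewrite /p /pd /Delta; pd_Delta z.
have Et : p (J0 (Ind vt)) = 0 by rewrite /p /pd /Delta; pd_Delta z.
have Eu : p (J0 Dep) = 0 by rewrite /p /pd /Delta; pd_Delta z.
have E1 : p (J1 vx) = a - b * z (J0 (Ind vx)) by rewrite /p /pd /Delta; pd_Delta z.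
have E2 : p (J1 vy) = d - e * z (J0 (Ind vy)) by rewrite /p /pd /Delta; pd_Delta z.
have E3 : p (J1 vt) = 1 by rewrite /p /pd /Delta; pd_Delta z.
have E4 : p Jxx = z (J0 (Ind vx)) / 2 by rewrite /p /pd /Delta; pd_Delta z.
have E5 : p Jyy = z (J0 (Ind vy)) / 2 by rewrite /p /pd /Delta; pd_Delta z.
have E6 : p Jxy = 0 by rewrite /p /pd /Delta; pd_Delta z.
have E7 : p Jxt = 0 by rewrite /p /pd /Delta; pd_Delta z.
have E8 : p Jyt = 0 by rewrite /p /pd /Delta; pd_Delta z.
have E9 : p Jtt = 0 by rewrite /p /pd /Delta; pd_Delta z.
rewrite /p in Ex Ey Et Eu E1 E2 E3 E4 E5 E6 E7 E8 E9.
rewrite /pr2 /sumv /sumi /pr2_Delta.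
by rewrite !(Ex, Ey, Et, Eu, E1, E2, E3, E4, E5, E6, E7, E8, E9); field.
Qed.

(** * Differentiation rules and smoothness on [dom] *)

Notation ix := (Ind vx).
Notation iy := (Ind vy).
Notation it := (Ind vt).

Lemma is_pd_eq (C : eqType) (c : C) f p l m : is_pd c f p l -> l = m -> pd c f p = m.
Proof. by move=> /is_pdE -> . Qed.

Lemma is_pd_inv (C : eqType) (c : C) f p l : f p <> 0 -> is_pd c f p l ->
  is_pd c (fun q => / f q) p (- / (f p * f p) * l).
Proof.
move=> f0; apply: (is_pd_comp (h := Rinv)); auto_derive => //.
by field.
Qed.

Lemma is_pd_sqrt (C : eqType) (c : C) f p l : 0 < f p -> is_pd c f p l ->
  is_pd c (fun q => sqrt (f q)) p (/ (2 * sqrt (f p)) * l).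
Proof.
move=> f0; apply: (is_pd_comp (h := sqrt)); auto_derive => //.
by field; have := sqrt_lt_R0 _ f0; lra.
Qed.

Lemma is_pd_exp (C : eqType) (c : C) f p l : is_pd c f p l ->
  is_pd c (fun q => exp (f q)) p (exp (f p) * l).
Proof. by apply: (is_pd_comp (h := exp)); auto_derive => //; ring. Qed.

Lemma continuous_coord (c : var) (p : pt) : continuous (fun q : pt => q c) p.
Proof. by move=> P [e Pe]; exists e => q pq; apply: Pe; exact: pq. Qed.

(** The recursion in [Ck] runs over [pd c f]; an explicit gradient, valid on [dom] only, may replace
    it. *)
Lemma Ck_intro k f (g : var -> pt -> R) :
  (forall p, dom p -> continuous f p) ->
  (forall c p, dom p -> is_pd c f p (g c p)) -> (forall c, Ck k (g c)) -> Ck k.+1 f.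
Proof.
move=> cf fg Cg; split=> // c; split=> [p dp|].
  by exists (g c p); exact: fg.
by apply: Ck_ext (Cg c) => p dp; apply: esym; apply: is_pdE; exact: fg.
Qed.

Lemma Ck_coord k c : Ck k (fun p => p c).
Proof.
case: k => [|k]; first by split=> // p _; exact: continuous_coord.
apply: (@Ck_intro k _ (fun d _ => if c == d then 1 else 0)) => [p _|d p _|d].
- exact: continuous_coord.
- by case: eqVneq => [->|cd]; [exact: is_pd_coord | exact: is_pd_coord_neq].
- exact: Ck_const.
Qed.

Lemma Ck_comp_coord k (h h' : R -> R) c :
  (forall p, dom p -> is_derive h (p c) (h' (p c))) ->
  Ck k (fun p => h' (p c)) -> Ck k.+1 (fun p => h (p c)).
Proof.
move=> hh' Ch'.
apply: (@Ck_intro k _ (fun d p => h' (p c) * (if c == d then 1 else 0)))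
    => [p dp|d p dp|d].
- apply: (continuous_comp (fun q : pt => q c) h); first exact: continuous_coord.
  by apply: ex_derive_continuous; exists (h' (p c)); exact: hh'.
- apply: is_pd_comp; first exact: hh'.
  by case: eqVneq => [->|cd]; [exact: is_pd_coord | exact: is_pd_coord_neq].
- by apply: Ck_mul => //; exact: Ck_const.
Qed.

(** The derivative of 1/sqrt s is -1/2 times its cube, so the induction closes on products of the
    function with itself. The square root is then obtained as s times 1/sqrt s. *)
Lemma Ck_isqrt k c : (forall p, dom p -> 0 < p c) -> Ck k (fun p => / sqrt (p c)).
Proof.
move=> pos; elim: k => [|k IH].
  split=> // p dp; apply: (continuous_comp (fun q : pt => q c) (fun s => / sqrt s)).
    exact: continuous_coord.
  apply: ex_derive_continuous; auto_derive.
  by have := sqrt_lt_R0 _ (pos _ dp); have := pos _ dp; split; lra.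
apply: (@Ck_comp_coord k (fun s => / sqrt s)
    (fun s => - (1 / 2) * (/ sqrt s * (/ sqrt s * / sqrt s)))) => [p dp|].
  have := sqrt_lt_R0 _ (pos _ dp); have := pos _ dp => p0 s0.
  by auto_derive; [split; lra | field; lra].
by do !apply: Ck_mul => //; exact: Ck_const.
Qed.

Lemma Ck_sqrt k c : (forall p, dom p -> 0 < p c) -> Ck k (fun p => sqrt (p c)).
Proof.
move=> pos; apply: (@Ck_ext k (fun p => p c * / sqrt (p c))) => [p dp|].
  rewrite -{1}(sqrt_sqrt (p c)); last by have := pos _ dp; lra.
  by field; have := sqrt_lt_R0 _ (pos _ dp); lra.
by apply: Ck_mul; [exact: Ck_coord | exact: Ck_isqrt].
Qed.

Lemma Ck_exp k (m : R) c : Ck k (fun p => exp (m * p c)).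
Proof.
elim: k => [|k IH].
  split=> // p dp; apply: (continuous_comp (fun q : pt => q c) (fun s => exp (m * s))).
    exact: continuous_coord.
  by apply: ex_derive_continuous; auto_derive.
apply: (@Ck_comp_coord k (fun s => exp (m * s)) (fun s => m * exp (m * s))) => [p dp|].
  by auto_derive => //; ring.
by apply: Ck_mul => //; exact: Ck_const.
Qed.

Lemma dom_x p : dom p -> 0 < p ix. Proof. by case. Qed.
Lemma dom_y p : dom p -> 0 < p iy. Proof. by case. Qed.
Lemma sqrt_x_gt0 p : dom p -> 0 < sqrt (p ix).
Proof. by case=> x0 _; exact: sqrt_lt_R0. Qed.
Lemma sqrt_y_gt0 p : dom p -> 0 < sqrt (p iy).
Proof. by case=> _ y0; exact: sqrt_lt_R0. Qed.
Lemma sqrt_x_sqr p : dom p -> p ix = sqrt (p ix) * sqrt (p ix).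
Proof. by case=> x0 _; rewrite sqrt_sqrt //; lra. Qed.
Lemma sqrt_y_sqr p : dom p -> p iy = sqrt (p iy) * sqrt (p iy).
Proof. by case=> _ y0; rewrite sqrt_sqrt //; lra. Qed.

Lemma Ck_sub k f g : Ck k f -> Ck k g -> Ck k (fun p => f p - g p).
Proof. by move=> Cf Cg; apply: Ck_add => //; exact: Ck_opp. Qed.

Ltac Ck_tac :=
  lazymatch goal with
  | |- smooth _ => let k := fresh in intro k; Ck_tac
  | |- Ck _ (fun=> ?a) => exact: Ck_const
  | |- Ck _ (fun q => q _) => exact: Ck_coord
  | |- Ck _ (fun q => @?f q + @?g q) => apply: (@Ck_add _ f g); Ck_tac
  | |- Ck _ (fun q => @?f q - @?g q) => apply: (@Ck_sub _ f g); Ck_tac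
  | |- Ck _ (fun q => @?f q * @?g q) => apply: (@Ck_mul _ f g); Ck_tac
  | |- Ck _ (fun q => - @?f q) => apply: (@Ck_opp _ f); Ck_tac
  | |- Ck _ (fun q => / sqrt (q _)) =>
      apply: Ck_isqrt; first [exact: dom_x | exact: dom_y]
  | |- Ck _ (fun q => sqrt (q _)) =>
      apply: Ck_sqrt; first [exact: dom_x | exact: dom_y]
  | |- Ck _ (fun q => exp (_ * q _)) => exact: Ck_exp
  | |- Ck ?k (fun q => ?f q) => change (Ck k f); Ck_tac
  | |- Ck _ (pd _ _) => apply: Ck_pd; Ck_tac
  | |- Ck _ (vcoef _ _) => exact: vcoef_smooth
  | |- Ck _ _ => solve [eauto]
  end.

Ltac pd_tac :=
  lazymatch goal with
  | |- is_pd _ (fun=> ?a) _ _ => exact: is_pd_const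
  | |- is_pd ?c (fun q => q ?c) _ _ => exact: is_pd_coord
  | |- is_pd _ (fun q => q _) _ _ => exact: is_pd_coord_neq
  | |- is_pd ?c (fun q => @?f q + @?g q) ?p _ => apply: (@is_pd_add _ c f g p); pd_tac
  | |- is_pd ?c (fun q => @?f q - @?g q) ?p _ => apply: (@is_pd_sub _ c f g p); pd_tac
  | |- is_pd ?c (fun q => @?f q * @?g q) ?p _ => apply: (@is_pd_mul _ c f g p); pd_tac
  | |- is_pd ?c (fun q => - @?f q) ?p _ => apply: (@is_pd_opp _ c f p); pd_tac
  | |- is_pd ?c (fun q => / @?f q) ?p _ =>
      apply: (@is_pd_inv _ c f p); [shelve | pd_tac]
  | |- is_pd ?c (fun q => sqrt (@?f q)) ?p _ =>
      apply: (@is_pd_sqrt _ c f p); [solve [eauto using dom_x, dom_y] | pd_tac]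
  | |- is_pd ?c (fun q => exp (@?f q)) ?p _ => apply: (@is_pd_exp _ c f p); pd_tac
  | |- is_pd ?c (fun q => ?f q) ?p _ =>
      apply: (@is_pd_Ck c f p); [solve [eauto] | Ck_tac]
  | |- is_pd ?c ?f ?p _ => apply: (@is_pd_Ck c f p); [solve [eauto] | Ck_tac]
  end.

(** Leaves first the nonvanishing of the denominators shelved by [pd_tac], then the equation with
    the expected value. *)
Ltac pd_compute := unshelve (apply: is_pd_eq; [pd_tac | idtac]).

(** * Determining equations *)

(* The parameters are [u_x, u_y, u_xx, u_xy, u_xt, u_yy, u_yt]; the value of [u_t]
   is the one forced by [Delta = 0]. *)
Definition sol_jet (a b d e : R) (p : pt) (q1 q2 qxx qxy qxt qyy qyt : R) : jet :=
  fun j => match j with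
  | J0 c => p c | J1 vx => q1 | J1 vy => q2
  | J1 vt => - ((a - b * p ix) * q1 + (d - e * p iy) * q2
                + p ix / 2 * qxx + p iy / 2 * qyy)
  | Jxx => qxx | Jxy => qxy | Jxt => qxt | Jyy => qyy | Jyt => qyt | Jtt => 0
  end.

Lemma Delta_sol_jet a b d e p q1 q2 qxx qxy qxt qyy qyt :
  Delta a b d e (sol_jet a b d e p q1 q2 qxx qxy qxt qyy qyt) = 0.
Proof. by rewrite /Delta /sol_jet; ring. Qed.

Lemma pd_eq0 (f : pt -> R) c : eq_dom f (fun=> 0) -> eq_dom (pd c f) (fun=> 0).
Proof. by move=> f0 p dp; rewrite (pd_ext c f0 dp) /pd Derive_const. Qed.

Section DeterminingEquations.
Variables (a b d e : R) (v : vfield).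
Local Notation xi := (vcoef v ix).
Local Notation ga := (vcoef v iy).
Local Notation tau := (vcoef v it).
Local Notation phi := (vcoef v Dep).

(** The last equation is the off-diagonal part of the conformal Killing equation for the metric
    dx^2/x + dy^2/y of the second-order terms. *)
Definition projectable := forall p, dom p ->
  [/\ pd Dep xi p = 0, pd Dep ga p = 0 & pd Dep tau p = 0] /\
  [/\ pd ix tau p = 0, pd iy tau p = 0 & p ix * pd ix ga p + p iy * pd iy xi p = 0].

(** [determining_x] and [determining_y] are the coefficients of u_x and u_y once u_t has been
    eliminated; [determining_u] collects the terms free of derivatives of u. *)
Definition determining_x p :=
  - b * xi p - (a - b * p ix) * pd ix xi p - (d - e * p iy) * pd iy xi p
  + p ix * pd ix (pd Dep phi) p - p ix / 2 * pd ix (pd ix xi) p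
  - p iy / 2 * pd iy (pd iy xi) p - pd it xi p + (a - b * p ix) * pd it tau p.

Definition determining_y p :=
  - e * ga p - (a - b * p ix) * pd ix ga p - (d - e * p iy) * pd iy ga p
  + p iy * pd iy (pd Dep phi) p - p ix / 2 * pd ix (pd ix ga) p
  - p iy / 2 * pd iy (pd iy ga) p - pd it ga p + (d - e * p iy) * pd it tau p.

Definition determining_u p :=
  (a - b * p ix) * pd ix phi p + (d - e * p iy) * pd iy phi p
  + p ix / 2 * pd ix (pd ix phi) p + p iy / 2 * pd iy (pd iy phi) p + pd it phi p.

(** The first two equations are twice the coefficients of u_xx and u_yy: the diagonal part of the
    conformal Killing equation. *)
Definition determining := forall p, dom p ->
  [/\ xi p - 2 * p ix * pd ix xi p + p ix * pd it tau p = 0,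
      ga p - 2 * p iy * pd iy ga p + p iy * pd it tau p = 0,
      determining_x p = 0, determining_y p = 0 & determining_u p = 0].

Hypothesis phi_lin : eq_dom (pd Dep (pd Dep phi)) (fun=> 0).

Lemma symmetry_projectable : inf_symmetry a b d e v -> projectable.
Proof.
move=> sym p dp.
have H q1 q2 qxx qxy qxt qyy qyt := sym (sol_jet a b d e p q1 q2 qxx qxy qxt qyy qyt)
   dp (Delta_sol_jet _ _ _ _ _ _ _ _ _ _ _ _).
have {sym}H q1 q2 qxx qxy qxt qyy qyt : 
   pr2_Delta a b d e v (sol_jet a b d e p q1 q2 qxx qxy qxt qyy qyt) = 0.
  by rewrite -pr2_DeltaE.
have x0 := dom_x dp; have y0 := dom_y dp.
have bz q1 q2 qxx qxy qxt qyy qyt :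
  base (sol_jet a b d e p q1 q2 qxx qxy qxt qyy qyt) = p by [].
(* Jets that differ only in u_xt, u_yt or u_xy isolate the coefficient of that mixed derivative;
   repeating this at u_x = 1 or u_y = 1 brings out its part in [pd Dep]. *)
have L0 := H 0 0 0 0 0 0 0; have Lx := H 0 0 0 0 1 0 0.
have Ly := H 0 0 0 0 0 0 1; have Lxy := H 0 0 0 1 0 0 0.
have L1 := H 1 0 0 0 0 0 0; have L1x := H 1 0 0 0 1 0 0; have L1xy := H 1 0 0 1 0 0 0.
have L2 := H 0 1 0 0 0 0 0; have L2xy := H 0 1 0 1 0 0 0.
do [rewrite /pr2_Delta !prolong1E !prolong2E // /D1 /D2 /sumi /lift !bz /=]
  in L0 Lx Ly Lxy L1 L1x L1xy L2 L2xy.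
have cancel (m n : R) : 0 < m -> m * n = 0 -> n = 0.
  by move=> m0 /Rmult_integral [] //; lra.
have E1 : p ix * pd ix tau p = 0 by clear -L0 Lx; lra.
have E2 : p iy * pd iy tau p = 0 by clear -L0 Ly; lra.
have E3 : p ix * pd Dep tau p = 0 by clear -L1 L1x E1; lra.
have E4 : p ix * pd ix ga p + p iy * pd iy xi p = 0 by clear -L0 Lxy; lra.
have E5 : p ix * pd Dep ga p = 0 by clear -L1 L1xy E4; lra.
have E6 : p iy * pd Dep xi p = 0 by clear -L2 L2xy E4; lra.
by do !split => //; first [exact: (cancel _ _ x0) | exact: (cancel _ _ y0)].
Qed.

(** Projectability and [phi_lin] remove every term that is nonlinear in the derivatives of u or
    contains a mixed one; the rest is affine in u_x, u_y, u_xx and u_yy. *)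
Lemma pr2_projectable (z : jet) : projectable -> dom (base z) -> Delta a b d e z = 0 ->
  let p := base z in
  pr2 v (Delta a b d e) z =
  z Jxx / 2 * (xi p - 2 * p ix * pd ix xi p + p ix * pd it tau p)
  + z Jyy / 2 * (ga p - 2 * p iy * pd iy ga p + p iy * pd it tau p)
  + z (J1 vx) * determining_x p + z (J1 vy) * determining_y p + determining_u p.
Proof.
move=> prj dz Dz /=; rewrite pr2_DeltaE /pr2_Delta !prolong1E !prolong2E //.
have S c f : eq_dom f (fun=> 0) -> pd c f (base z) = 0.
  by move=> f0; rewrite (pd_eq0 c f0 dz).
have xu : eq_dom (pd Dep xi) (fun=> 0) by move=> p /prj [[]].
have gu : eq_dom (pd Dep ga) (fun=> 0) by move=> p /prj [[]].
have tu : eq_dom (pd Dep tau) (fun=> 0) by move=> p /prj [[]].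
have tx : eq_dom (pd ix tau) (fun=> 0) by move=> p /prj [_ []].
have ty : eq_dom (pd iy tau) (fun=> 0) by move=> p /prj [_ []].
have [_ [_ _ E]] := prj _ dz.
rewrite /D1 /D2 /sumi /lift /= !(S _ _ xu) !(S _ _ gu) !(S _ _ tu) !(S _ _ tx)
  !(S _ _ ty) !xu // !gu // !tu // !tx // !ty // !phi_lin //.
rewrite /determining_x /determining_y /determining_u.
move: E Dz; rewrite /Delta /base; set X := z (J0 ix); set Y := z (J0 iy).
move=> E Dz.
have -> : z (J1 vt) = - ((a - b * X) * z (J1 vx) + (d - e * Y) * z (J1 vy)
                + X / 2 * z Jxx + Y / 2 * z Jyy) by lra.
set gx := pd ix ga _; set xy := pd iy xi _.
(* The two sides differ by minus this product, the u_xy term. *)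
have E' : z Jxy * (X * gx + Y * xy) = 0 by rewrite E; ring.
apply: Rminus_diag_uniq; rewrite -[RHS]Ropp_0 -[in RHS]E'.
by field.
Qed.

Lemma symmetry_determining : projectable -> inf_symmetry a b d e v <-> determining.
Proof.
move=> prj; split=> [sym p dp|det z dz Dz]; last first.
  rewrite pr2_projectable //=.
  by have [-> -> -> -> ->] := det _ dz; field.
have H q1 q2 qxx qyy :
    qxx / 2 * (xi p - 2 * p ix * pd ix xi p + p ix * pd it tau p)
  + qyy / 2 * (ga p - 2 * p iy * pd iy ga p + p iy * pd it tau p)
  + q1 * determining_x p + q2 * determining_y p + determining_u p = 0.
  have Dz := Delta_sol_jet a b d e p q1 q2 qxx 0 0 qyy 0.
  rewrite -(sym (sol_jet a b d e p q1 q2 qxx 0 0 qyy 0) dp Dz).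
  exact: esym (pr2_projectable prj dp Dz).
(* The origin and the four unit vectors give the five coefficients of this affine function. *)
have H0 := H 0 0 0 0; have H1 := H 1 0 0 0; have H2 := H 0 1 0 0.
have H3 := H 0 0 1 0; have H4 := H 0 0 0 1.
by split; lra.
Qed.

End DeterminingEquations.

(** * Integration of the determining equations *)

(** [dom] is an upward closed quadrant in x and y, so a lower bound on [r] keeps the coordinate line
    inside. *)
Lemma dom_between p c s r : dom p -> dom (upd p c s) ->
  Rmin (p c) s <= r -> dom (upd p c r).
Proof.
move=> [x0 y0]; case: c => [[]|] [hx hy] mr //; split=> //.
- by have := Rmin_pos _ _ x0 hx; rewrite /= in mr *; move: mr; rewrite /upd /=; lra.
- by have := Rmin_pos _ _ y0 hy; rewrite /= in mr *; move: mr; rewrite /upd /=; lra.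
Qed.

Lemma pd0_upd f c p s : smooth f -> (forall q, dom q -> pd c f q = 0) ->
  dom p -> dom (upd p c s) -> f (upd p c s) = f p.
Proof.
move=> Cf f0 dp dps.
have D r : Rmin (p c) s <= r -> is_derive (fun r => f (upd p c r)) r 0.
  move=> mr; have dr := dom_between dp dps mr.
  have := is_pd_Ck c dr (Cf 1%N); rewrite f0 // /is_pd upd_eq.
  by apply: is_derive_ext => t; rewrite upd_upd.
have Dpc := Rmin_l (p c) s; have Ds := Rmin_r (p c) s.
rewrite -[in RHS](upd_id p c).
have [lt|[eq|gt]] := Rtotal_order (p c) s.
- symmetry; apply: (eq_is_derive (fun r => f (upd p c r))) => // r [hr _].
  by apply: D; lra.
- by rewrite -eq.
- apply: (eq_is_derive (fun r => f (upd p c r))) => // r [hr _].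
  by apply: D; lra.
Qed.

(** Stated by derivatives, so that it passes to [pd it f]; [time_onlyE] recovers the dependence on t
    alone by moving one coordinate at a time inside [dom]. *)
Definition time_only (f : pt -> R) := smooth f /\
  forall p, dom p -> [/\ pd ix f p = 0, pd iy f p = 0 & pd Dep f p = 0].

Definition pt_of (x y t u : R) : pt := vcomp x y t u.

Lemma dom_pt_of x y t u : 0 < x -> 0 < y -> dom (pt_of x y t u).
Proof. by []. Qed.

Lemma time_onlyE f p x y u : time_only f -> dom p -> 0 < x -> 0 < y ->
  f (pt_of x y (p it) u) = f p.
Proof.
move=> [Cf f0] dp x0 y0.
have -> : pt_of x y (p it) u = upd (upd (upd p ix x) iy y) Dep u.
  by apply: funext => -[[]|].
have d1 : dom (upd p ix x) by case: dp.
have d2 : dom (upd (upd p ix x) iy y) by [].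
rewrite pd0_upd //; last by move=> q /f0 [].
rewrite pd0_upd //; last by move=> q /f0 [].
by rewrite pd0_upd // => q /f0 [].
Qed.

Lemma time_only_const f : time_only f -> (forall p, dom p -> pd it f p = 0) ->
  exists a, forall p, dom p -> f p = a.
Proof.
move=> tf f0; have d1 : dom (pt_of 1 1 0 0) by apply: dom_pt_of; lra.
exists (f (pt_of 1 1 0 0)) => p dp.
have [Cf _] := tf.
have -> : f (pt_of 1 1 0 0) = f (upd (pt_of 1 1 0 0) it (p it)).
  by rewrite pd0_upd.
have -> : upd (pt_of 1 1 0 0) it (p it) = pt_of 1 1 (p it) 0.
  by apply: funext => -[[]|].
by rewrite time_onlyE //; lra.
Qed.

Lemma time_only_pd f : time_only f -> time_only (pd it f).
Proof.
move=> [Cf f0]; split=> [k|p dp]; first exact: Ck_pd.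
have S c : eq_dom (pd c f) (fun=> 0) -> pd c (pd it f) p = 0.
  move=> fc; rewrite pd_comm //; first exact: pd_eq0 dp.
by split; apply: S => q /f0 [].
Qed.

Lemma time_only_lin f g m n : time_only f -> time_only g -> time_only (fun p => m * f p + n * g p).
Proof.
move=> [Cf f0] [Cg g0]; split=> [|p dp]; first by Ck_tac.
have [fx fy fu] := f0 _ dp; have [gx gy gu] := g0 _ dp.
by split; pd_compute; rewrite /= ?fx ?fy ?fu ?gx ?gy ?gu; ring.
Qed.

(** The product f exp(-m t) has zero derivative. *)
Lemma time_only_exp_ode f m : time_only f -> (forall p, dom p -> pd it f p = m * f p) ->
  exists a, forall p, dom p -> f p = a * exp (m * p it).
Proof.
move=> [Cf f0] fm.
have [|p dp|a fa] := @time_only_const (fun p => f p * exp (- m * p it)).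
- split=> [|p dp]; first by Ck_tac.
  by have [fx fy fu] := f0 _ dp; split; pd_compute; rewrite /= ?fx ?fy ?fu; ring.
- by pd_compute; rewrite /= fm //; ring.
exists a => p dp; rewrite -(fa p dp) Rmult_assoc -exp_plus.
have -> : - m * p it + m * p it = 0 by ring.
by rewrite exp_0; ring.
Qed.

(** The operator factors: f' + m f and f' - m f solve first-order equations with rates m and -m, and
    their difference is 2 m f. *)
Lemma time_only_cosh_ode f m : m <> 0 -> time_only f ->
  (forall p, dom p -> pd it (pd it f) p = m * m * f p) ->
  exists a1 a2, forall p, dom p -> f p = a1 * exp (m * p it) + a2 * exp (- m * p it).
Proof.
move=> m0 tf f2; have tf' := time_only_pd tf.
have [Cf _] := tf.
have [p dp|a1 fa1] := @time_only_exp_ode (fun p => 1 * pd it f p + m * f p) m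
  (time_only_lin _ _ tf' tf).
  by pd_compute; rewrite /= f2 //; ring.
have [p dp|a2 fa2] := @time_only_exp_ode (fun p => 1 * pd it f p + - m * f p) (- m)
  (time_only_lin _ _ tf' tf).
  by pd_compute; rewrite /= f2 //; ring.
exists (a1 / (2 * m)), (- a2 / (2 * m)) => p dp.
have := fa1 _ dp; have := fa2 _ dp => h2 h1.
have -> : f p = ((1 * pd it f p + m * f p) - (1 * pd it f p + - m * f p)) / (2 * m).
  by field.
by rewrite h1 h2; field.
Qed.

Lemma eq_divr m n l : m <> 0 -> m * n = l -> n = l / m.
Proof. by move=> m0 <-; field. Qed.

(* In the coordinates [sqrt x], [sqrt y] the equations say that the spatial part
   of the field is a dilation plus an infinitesimal rotation (of rate [k]) plus a
   translation. *)
Lemma conformal_form xi ga tau :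
  smooth xi -> smooth ga -> time_only tau ->
  (forall p, dom p -> [/\ pd Dep xi p = 0, pd Dep ga p = 0 &
                          p ix * pd ix ga p + p iy * pd iy xi p = 0]) ->
  (forall p, dom p -> xi p - 2 * p ix * pd ix xi p + p ix * pd it tau p = 0) ->
  (forall p, dom p -> ga p - 2 * p iy * pd iy ga p + p iy * pd it tau p = 0) ->
  exists k al be, [/\ time_only k, time_only al & time_only be] /\ forall p, dom p ->
    xi p = pd it tau p * p ix - 2 * k p * (sqrt (p ix) * sqrt (p iy))
           + 2 * al p * sqrt (p ix) /\
    ga p = pd it tau p * p iy + 2 * k p * (sqrt (p ix) * sqrt (p iy))
           + 2 * be p * sqrt (p iy).
Proof.
move=> Cxi Cga ttau H1 Hx Hy.
have [Ct _] := ttau; have [_ t1] := time_only_pd ttau.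
(* The components of the field along sqrt x and sqrt y without their dilation part. The diagonal
   equations say that [al0] is free of x and [be0] free of y. *)
pose al0 p := (xi p * / sqrt (p ix) - pd it tau p * sqrt (p ix)) * / 2.
pose be0 p := (ga p * / sqrt (p iy) - pd it tau p * sqrt (p iy)) * / 2.
have Cal0 : smooth al0 by rewrite /al0; Ck_tac.
have Cbe0 : smooth be0 by rewrite /be0; Ck_tac.
have al0x : eq_dom (pd ix al0) (fun=> 0).
  move=> p dp; have [tx _ _] := t1 _ dp; have s0 := sqrt_x_gt0 dp.
  rewrite /al0; pd_compute; rewrite /= ?tx; try lra.
  have := Hx _ dp; rewrite {1 2}(sqrt_x_sqr dp) => E.
  have -> : pd ix xi p = (xi p + (sqrt (p ix) * sqrt (p ix)) * pd it tau p)
      / (2 * (sqrt (p ix) * sqrt (p ix))).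
    by apply: eq_divr; [nra | lra].
  by field; lra.
have be0y : eq_dom (pd iy be0) (fun=> 0).
  move=> p dp; have [_ ty _] := t1 _ dp; have s0 := sqrt_y_gt0 dp.
  rewrite /be0; pd_compute; rewrite /= ?ty; try lra.
  have := Hy _ dp; rewrite {1 2}(sqrt_y_sqr dp) => E.
  have -> : pd iy ga p = (ga p + (sqrt (p iy) * sqrt (p iy)) * pd it tau p)
      / (2 * (sqrt (p iy) * sqrt (p iy))).
    by apply: eq_divr; [nra | lra].
  by field; lra.
have al0u : eq_dom (pd Dep al0) (fun=> 0).
  move=> p dp; have [_ _ tu] := t1 _ dp; have s0 := sqrt_x_gt0 dp.
  have [xu _ _] := H1 _ dp.
  by rewrite /al0; pd_compute; rewrite /= ?tu ?xu; try lra; field; lra.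
have be0u : eq_dom (pd Dep be0) (fun=> 0).
  move=> p dp; have [_ _ tu] := t1 _ dp; have s0 := sqrt_y_gt0 dp.
  have [_ gu _] := H1 _ dp.
  by rewrite /be0; pd_compute; rewrite /= ?tu ?gu; try lra; field; lra.
have al0y p : dom p -> pd iy al0 p = pd iy xi p / (2 * sqrt (p ix)).
  move=> dp; have [_ ty _] := t1 _ dp; have s0 := sqrt_x_gt0 dp.
  by rewrite /al0; pd_compute; rewrite /= ?ty; try lra; field; lra.
have be0x p : dom p -> pd ix be0 p = pd ix ga p / (2 * sqrt (p iy)).
  move=> dp; have [tx _ _] := t1 _ dp; have s0 := sqrt_y_gt0 dp.
  by rewrite /be0; pd_compute; rewrite /= ?tx; try lra; field; lra.
(* In the coordinates s = sqrt x and r = sqrt y, these are minus the r-derivative of [al0] and the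
   s-derivative of [be0]; the off-diagonal equation makes them equal. *)
pose k p := - 2 * sqrt (p iy) * pd iy al0 p.
pose k' p := 2 * sqrt (p ix) * pd ix be0 p.
have kk' : eq_dom k k'.
  move=> p dp; rewrite /k /k' al0y // be0x //.
  have s0 := sqrt_x_gt0 dp; have r0 := sqrt_y_gt0 dp.
  have [_ _] := H1 _ dp.
  rewrite {1}(sqrt_x_sqr dp) {1}(sqrt_y_sqr dp) => E.
  apply: Rminus_diag_uniq.
  transitivity (- (sqrt (p ix) * sqrt (p ix) * pd ix ga p +
      sqrt (p iy) * sqrt (p iy) * pd iy xi p) / (sqrt (p ix) * sqrt (p iy))).
    by field; lra.
  by rewrite E; field; lra.
have Ck' : smooth k by rewrite /k; Ck_tac.
have swap c d f p : smooth f -> dom p -> eq_dom (pd d f) (fun=> 0) -> pd d (pd c f) p = 0.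
  by move=> Cf dp f0; rewrite pd_comm //; exact: pd_eq0 dp.
(* The first expression of the rate is free of x, the second of y. *)
have tk : time_only k.
  split=> // p dp; split.
  - by rewrite /k; pd_compute; rewrite /= (swap iy ix) //; ring.
  - rewrite (pd_ext iy kk' dp) /k'.
    by pd_compute; rewrite /= (swap ix iy) //; ring.
  - by rewrite /k; pd_compute; rewrite /= (swap iy Dep) //; ring.
have [_ k0] := tk.
(* Removing the rotation from [al0] and [be0] leaves the translations. *)
exists k, (fun p => al0 p + k p * sqrt (p iy)), (fun p => be0 p - k p * sqrt (p ix)).
split.
  split=> //; split; try by Ck_tac.
  - move=> p dp; have [kx ky ku] := k0 _ dp; have r0 := sqrt_y_gt0 dp.
    split; pd_compute; rewrite /= ?kx ?ky ?ku ?al0x ?al0u //; try ring.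
    by rewrite /k; field; lra.
  - move=> p dp; have [kx ky ku] := k0 _ dp; have s0 := sqrt_x_gt0 dp.
    split; pd_compute; rewrite /= ?kx ?ky ?ku ?be0y ?be0u //; try ring.
    by rewrite kk' // /k'; field; lra.
move=> p dp; have s0 := sqrt_x_gt0 dp; have r0 := sqrt_y_gt0 dp.
rewrite /al0 /be0 {1}(sqrt_x_sqr dp) {3}(sqrt_y_sqr dp).
by split; field; lra.
Qed.

(** Solves the equation [n = 0] for the unknown [l]: [m] is the factor that normalises its
    coefficient, and [field] checks the solution. *)
Lemma eq_from0 m n l h : n = 0 -> l - h = n * m -> l = h.
Proof. by move=> -> lh; lra. Qed.

(** * Derivatives of the dilation, rotation and translation form *)

Section FormDerivatives.
Variables (T k al : pt -> R).
Hypotheses (tT : time_only T) (tk : time_only k) (tal : time_only al).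

Let CT : smooth T. Proof. by case: tT. Qed.
Let Ck_ : smooth k. Proof. by case: tk. Qed.
Let Cal : smooth al. Proof. by case: tal. Qed.

Ltac form_tac dp :=
  let s0 := fresh in let r0 := fresh in
  have s0 := sqrt_x_gt0 dp; have r0 := sqrt_y_gt0 dp;
  let a := fresh in let b := fresh in let c := fresh in
  have [a b c] := proj2 tT _ dp; rewrite /= ?a ?b ?c; clear a b c;
  have [a b c] := proj2 tk _ dp; rewrite /= ?a ?b ?c; clear a b c;
  have [a b c] := proj2 tal _ dp; rewrite /= ?a ?b ?c; clear a b c;
  let Ex := fresh in have Ex := sqrt_x_sqr dp;
  let Ey := fresh in have Ey := sqrt_y_sqr dp;
  lazymatch type of dp with dom ?p =>
    revert s0 r0 Ex Ey; generalize (sqrt (p ix)) (sqrt (p iy)) end;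
  intros ? ? s0 r0 Ex Ey; rewrite ?Ex ?Ey; first [lra | field; lra].

Lemma form_pd_x f :
  (forall p, dom p -> f p = T p * p ix - 2 * k p * (sqrt (p ix) * sqrt (p iy))
     + 2 * al p * sqrt (p ix)) ->
  forall p, dom p -> let s := sqrt (p ix) in let r := sqrt (p iy) in
  [/\ pd ix f p = T p - k p * r / s + al p / s,
      pd iy f p = - k p * s / r,
      pd it f p = pd it T p * s * s - 2 * pd it k p * s * r + 2 * pd it al p * s,
      pd ix (pd ix f) p = (k p * r - al p) / (2 * s * s * s) &
      pd iy (pd iy f) p = k p * s / (2 * r * r * r)].
Proof.
move=> fE.
have fx : eq_dom (pd ix f) (fun p => T p - k p * sqrt (p iy) * / sqrt (p ix) + al p * / sqrt (p ix)).
  by move=> p dp; rewrite (pd_ext ix fE dp); pd_compute; form_tac dp.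
have fy : eq_dom (pd iy f) (fun p => - k p * sqrt (p ix) * / sqrt (p iy)).
  by move=> p dp; rewrite (pd_ext iy fE dp); pd_compute; form_tac dp.
move=> p dp s r; split; rewrite ?fx ?fy //.
- by rewrite (pd_ext it fE dp) /s /r; pd_compute; form_tac dp.
- by rewrite (pd_ext ix fx dp) /s /r; pd_compute; form_tac dp.
- by rewrite (pd_ext iy fy dp) /s /r; pd_compute; form_tac dp.
Qed.

Lemma form_pd_y f :
  (forall p, dom p -> f p = T p * p iy + 2 * k p * (sqrt (p ix) * sqrt (p iy))
     + 2 * al p * sqrt (p iy)) ->
  forall p, dom p -> let s := sqrt (p ix) in let r := sqrt (p iy) in
  [/\ pd iy f p = T p + k p * s / r + al p / r,
      pd ix f p = k p * r / s,
      pd it f p = pd it T p * r * r + 2 * pd it k p * s * r + 2 * pd it al p * r,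
      pd iy (pd iy f) p = - (k p * s + al p) / (2 * r * r * r) &
      pd ix (pd ix f) p = - k p * r / (2 * s * s * s)].
Proof.
move=> fE.
have fy : eq_dom (pd iy f) (fun p => T p + k p * sqrt (p ix) * / sqrt (p iy) + al p * / sqrt (p iy)).
  by move=> p dp; rewrite (pd_ext iy fE dp); pd_compute; form_tac dp.
have fx : eq_dom (pd ix f) (fun p => k p * sqrt (p iy) * / sqrt (p ix)).
  by move=> p dp; rewrite (pd_ext ix fE dp); pd_compute; form_tac dp.
move=> p dp s r; split; rewrite ?fx ?fy //.
- by rewrite (pd_ext it fE dp) /s /r; pd_compute; form_tac dp.
- by rewrite (pd_ext iy fy dp) /s /r; pd_compute; form_tac dp.
- by rewrite (pd_ext ix fx dp) /s /r; pd_compute; form_tac dp.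
Qed.

End FormDerivatives.

(** * The multiplier lambda and the resulting ODEs *)

Section Multiplier.
Variables (b : R) (v : vfield) (k al be : pt -> R).
Local Notation xi := (vcoef v ix).
Local Notation ga := (vcoef v iy).
Local Notation T := (pd it (vcoef v it)).
Local Notation phi := (vcoef v Dep).
Local Notation l := (pd Dep phi).

Hypothesis det : determining (1 / 4) b (1 / 4) (- b) v.
Hypotheses (tT : time_only T) (tk : time_only k) (tal : time_only al) (tbe : time_only be).
Hypothesis xiE : forall p, dom p ->
  xi p = T p * p ix - 2 * k p * (sqrt (p ix) * sqrt (p iy)) + 2 * al p * sqrt (p ix).
Hypothesis gaE : forall p, dom p ->
  ga p = T p * p iy + 2 * k p * (sqrt (p ix) * sqrt (p iy)) + 2 * be p * sqrt (p iy).
Hypothesis phiE : forall p, dom p -> phi p = l p * p Dep.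
Hypothesis lu : forall p, dom p -> pd Dep l p = 0.

(** With drift constants 1/4, the second derivatives of [xi] cancel against the constant drift
    terms; what is left is linear in lambda_x with coefficient x. *)
Lemma multiplier_x p : dom p -> pd ix l p = pd it T p + b * T p
  + 2 * (pd it al p + b / 2 * al p - (pd it k p + b * k p) * sqrt (p iy)) * / sqrt (p ix).
Proof.
move=> dp; have s0 := sqrt_x_gt0 dp; have r0 := sqrt_y_gt0 dp.
have [_ _ + _ _] := det dp.
have /= [X1 X2 X3 X4 X5] := form_pd_x tT tk tal xiE dp.
rewrite /determining_x xiE // X1 X2 X3 X4 X5 => E.
have Ex := sqrt_x_sqr dp; have Ey := sqrt_y_sqr dp.
set s := sqrt (p ix) in s0 Ex E *; set r := sqrt (p iy) in r0 Ey E *.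
rewrite Ex Ey in E; move: E.
by move/(eq_from0 (m := / (s * s))); apply; field; lra.
Qed.

Lemma multiplier_y p : dom p -> pd iy l p = pd it T p - b * T p
  + 2 * (pd it be p - b / 2 * be p + (pd it k p - b * k p) * sqrt (p ix)) * / sqrt (p iy).
Proof.
move=> dp; have s0 := sqrt_x_gt0 dp; have r0 := sqrt_y_gt0 dp.
have [_ _ _ + _] := det dp.
have /= [X1 X2 X3 X4 X5] := form_pd_y tT tk tbe gaE dp.
rewrite /determining_y gaE // X1 X2 X3 X4 X5 => E.
have Ex := sqrt_x_sqr dp; have Ey := sqrt_y_sqr dp.
set s := sqrt (p ix) in s0 Ex E *; set r := sqrt (p iy) in r0 Ey E *.
rewrite Ex Ey in E; move: E.
by move/(eq_from0 (m := / (r * r))); apply; field; lra.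
Qed.

Let CT : smooth T. Proof. by case: tT. Qed.
Let Ck_ : smooth k. Proof. by case: tk. Qed.
Let Cal : smooth al. Proof. by case: tal. Qed.
Let Cbe : smooth be. Proof. by case: tbe. Qed.
Let Cl : smooth l. Proof. by move=> n; apply: Ck_pd; exact: vcoef_Ck. Qed.

(** With s = sqrt x and r = sqrt y the mixed derivatives of lambda are -(k' + b k)/(s r) and (k' - b
    k)/(s r). The terms in b k agree, which leaves k' = 0. *)
Lemma rotation_rate_const p : dom p -> pd it k p = 0.
Proof.
move=> dp; have s0 := sqrt_x_gt0 dp; have r0 := sqrt_y_gt0 dp.
have [Tx Ty _] := proj2 tT _ dp; have [T2x T2y _] := proj2 (time_only_pd tT) _ dp.
have [kx ky _] := proj2 tk _ dp; have [k2x k2y _] := proj2 (time_only_pd tk) _ dp.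
have [ax ay _] := proj2 tal _ dp; have [a2x a2y _] := proj2 (time_only_pd tal) _ dp.
have [ex ey _] := proj2 tbe _ dp; have [e2x e2y _] := proj2 (time_only_pd tbe) _ dp.
have Exy : pd iy (pd ix l) p =
    - (pd it k p + b * k p) * / (sqrt (p ix) * sqrt (p iy)).
  rewrite (pd_ext iy multiplier_x dp); pd_compute; first lra.
  by rewrite /= Ty T2y ky k2y ay a2y; field; lra.
have Eyx : pd ix (pd iy l) p =
    (pd it k p - b * k p) * / (sqrt (p ix) * sqrt (p iy)).
  rewrite (pd_ext ix multiplier_y dp); pd_compute; first lra.
  by rewrite /= Tx T2x kx k2x ex e2x; field; lra.
have := pd_comm ix iy (Cl 2%N) dp; rewrite Exy Eyx => /Rmult_eq_reg_r E.
suff: pd it k p - b * k p = - (pd it k p + b * k p) by lra.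
by apply: E; apply: Rinv_neq_0_compat; nra.
Qed.

(** A primitive of the gradient in [multiplier_x] and [multiplier_y] when k' = 0. *)
Definition multiplier_part p :=
  pd it T p * (p ix + p iy) + b * T p * (p ix - p iy)
  - 4 * b * k p * (sqrt (p ix) * sqrt (p iy))
  + 4 * (pd it al p + b / 2 * al p) * sqrt (p ix)
  + 4 * (pd it be p - b / 2 * be p) * sqrt (p iy).

Lemma multiplier_form : exists c, time_only c /\ forall p, dom p -> l p = multiplier_part p + c p.
Proof.
exists (fun p => l p - multiplier_part p); split; last by move=> p dp; ring.
split=> [|p dp]; first by rewrite /multiplier_part; Ck_tac.
have s0 := sqrt_x_gt0 dp; have r0 := sqrt_y_gt0 dp.
have k0 := rotation_rate_const dp.
have [Tx Ty Tu] := proj2 tT _ dp; have [T2x T2y T2u] := proj2 (time_only_pd tT) _ dp.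
have [kx ky ku] := proj2 tk _ dp.
have [ax ay au] := proj2 tal _ dp; have [a2x a2y a2u] := proj2 (time_only_pd tal) _ dp.
have [ex ey eu] := proj2 tbe _ dp; have [e2x e2y e2u] := proj2 (time_only_pd tbe) _ dp.
rewrite /multiplier_part; split; pd_compute.
- by rewrite /= multiplier_x // Tx T2x kx ax a2x ex e2x k0; field; lra.
- by rewrite /= multiplier_y // Ty T2y ky ay a2y ey e2y k0; field; lra.
- by rewrite /= lu // Tu T2u ku au a2u eu e2u; ring.
Qed.

Lemma multiplier_ode c : time_only c ->
  (forall p, dom p -> l p = multiplier_part p + c p) ->
  forall p, dom p ->
  [/\ pd it c p = - pd it T p / 2, pd it (pd it T) p = b * b * T p,
      pd it (pd it al) p = b / 2 * (b / 2) * al p &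
      pd it (pd it be) p = b / 2 * (b / 2) * be p].
Proof.
move=> tc lE.
have Cc : smooth c by case: tc.
have phix : eq_dom (pd ix phi) (fun p => pd ix l p * p Dep).
  by move=> p dp; rewrite (pd_ext ix phiE dp); pd_compute; rewrite /=; ring.
have phiy : eq_dom (pd iy phi) (fun p => pd iy l p * p Dep).
  by move=> p dp; rewrite (pd_ext iy phiE dp); pd_compute; rewrite /=; ring.
(* At u = 1 the derivatives of phi along x, y and t are those of lambda, so the last determining
   equation becomes the original PDE for lambda. *)
have main p : dom p -> p Dep = 1 ->
  pd it c p + pd it T p / 2 + (p ix + p iy) * (pd it (pd it T) p - b * b * T p)
  + 4 * sqrt (p ix) * (pd it (pd it al) p - b / 2 * (b / 2) * al p)
  + 4 * sqrt (p iy) * (pd it (pd it be) p - b / 2 * (b / 2) * be p) = 0.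
  move=> dp u1; have s0 := sqrt_x_gt0 dp; have r0 := sqrt_y_gt0 dp.
  have [_ _ _ _] := det dp; rewrite /determining_u phix // phiy //.
  have k0 := rotation_rate_const dp.
  have [Tx Ty _] := proj2 tT _ dp; have [T2x T2y _] := proj2 (time_only_pd tT) _ dp.
  have [kx ky _] := proj2 tk _ dp; have [k2x k2y _] := proj2 (time_only_pd tk) _ dp.
  have [ax ay _] := proj2 tal _ dp; have [a2x a2y _] := proj2 (time_only_pd tal) _ dp.
  have [ex ey _] := proj2 tbe _ dp; have [e2x e2y _] := proj2 (time_only_pd tbe) _ dp.
  have -> : pd ix (pd ix phi) p = pd ix (pd ix l) p.
    by rewrite (pd_ext ix phix dp); pd_compute; rewrite /= u1; ring.
  have -> : pd iy (pd iy phi) p = pd iy (pd iy l) p.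
    by rewrite (pd_ext iy phiy dp); pd_compute; rewrite /= u1; ring.
  have -> : pd it phi p = pd it l p.
    by rewrite (pd_ext it phiE dp); pd_compute; rewrite /= u1; ring.
  have -> : pd ix (pd ix l) p =
      - (pd it al p + b / 2 * al p - b * k p * sqrt (p iy))
      / (sqrt (p ix) * sqrt (p ix) * sqrt (p ix)).
    rewrite (pd_ext ix multiplier_x dp); pd_compute; first lra.
    by rewrite /= Tx T2x kx k2x ax a2x k0; field; lra.
  have -> : pd iy (pd iy l) p =
      - (pd it be p - b / 2 * be p - b * k p * sqrt (p ix))
      / (sqrt (p iy) * sqrt (p iy) * sqrt (p iy)).
    rewrite (pd_ext iy multiplier_y dp); pd_compute; first lra.
    by rewrite /= Ty T2y ky k2y ey e2y k0; field; lra.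
  have -> : pd it l p =
      pd it (pd it T) p * (p ix + p iy) + b * pd it T p * (p ix - p iy)
      + 4 * (pd it (pd it al) p + b / 2 * pd it al p) * sqrt (p ix)
      + 4 * (pd it (pd it be) p - b / 2 * pd it be p) * sqrt (p iy) + pd it c p.
    rewrite (pd_ext it lE dp) /multiplier_part.
    by pd_compute; rewrite /= k0; field; lra.
  rewrite multiplier_x // multiplier_y // k0 u1 => E.
  have Ex := sqrt_x_sqr dp; have Ey := sqrt_y_sqr dp.
  move: s0 r0 Ex Ey E; generalize (sqrt (p ix)) (sqrt (p iy)) => s r s0 r0 Ex Ey.
  rewrite Ex Ey; move/(eq_from0 (m := 1)); apply.
  by field; lra.
move=> p dp.
have tc' := time_only_pd tc; have tT' := time_only_pd tT; have tT2 := time_only_pd tT'.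
have tal2 := time_only_pd (time_only_pd tal); have tbe2 := time_only_pd (time_only_pd tbe).
(* All coefficients depend on t only, so x = n^2 and y = m^2 may be chosen freely at the time of
   [p]. *)
have at_ n m : 0 < n -> 0 < m ->
  pd it c p + pd it T p / 2 + (n * n + m * m) * (pd it (pd it T) p - b * b * T p)
  + 4 * n * (pd it (pd it al) p - b / 2 * (b / 2) * al p)
  + 4 * m * (pd it (pd it be) p - b / 2 * (b / 2) * be p) = 0.
  move=> n0 m0; have n2 : 0 < n * n by nra.
  have m2 : 0 < m * m by nra.
  have := @main (pt_of (n * n) (m * m) (p it) 1) (dom_pt_of _ _ n2 m2) erefl.
  rewrite (time_onlyE 1 tc' dp) // (time_onlyE 1 tT' dp) // (time_onlyE 1 tT2 dp) //.
  rewrite (time_onlyE 1 tal2 dp) // (time_onlyE 1 tbe2 dp) // (time_onlyE 1 tT dp) //.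
  rewrite (time_onlyE 1 tal dp) // (time_onlyE 1 tbe dp) //.
  by rewrite /pt_of /= !sqrt_square; lra.
have h1 : 0 < 1 by lra. have h2 : 0 < 2 by lra. have h3 : 0 < 3 by lra.
(* These five points force the coefficients of 1, n^2 + m^2, n and m to vanish. *)
have A11 := at_ _ _ h1 h1; have A21 := at_ _ _ h2 h1; have A31 := at_ _ _ h3 h1.
have A12 := at_ _ _ h1 h2; have A13 := at_ _ _ h1 h3.
by split; lra.
Qed.

End Multiplier.

(** * The nine generators *)

Section Generators.
Variable b : R.
Implicit Types (c d : 'rV[R]_9) (p : pt).

Definition cf c (i : nat) : R := c ord0 (inord i).

(** Short sequences are padded with 0, which [sl2_row] relies on. *)
Definition row_of_seq (s : seq R) : 'rV[R]_9 := \row_i nth 0 s i.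

Lemma cf_row_of_seq s i : (i < 9)%N -> cf (row_of_seq s) i = nth 0 s i.
Proof. by move=> i9; rewrite /cf mxE inordK. Qed.

Lemma cf_lin (m : R) c d i : cf (m *: c + d)%R i = m * cf c i + cf d i.
Proof. by rewrite /cf !mxE. Qed.

Lemma cf_inj c d : (forall i, (i < 9)%N -> cf c i = cf d i) -> c = d.
Proof.
move=> cd; apply/rowP => i.
by have := cd i (ltn_ord i); rewrite /cf inord_val !ord1.
Qed.

Definition e1 p := exp (b / 2 * p it).
Definition e2 p := exp (- (b / 2) * p it).

(** This and the two shifts are the functions tau', al and be of [conformal_form] for the
    combination; its rotation rate k is minus half of [cf c 3]. *)
Definition comb_dilation c p := b * (cf c 0 * (e1 p * e1 p) - cf c 1 * (e2 p * e2 p)).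
Definition comb_shift_x c p := 1 / 2 * (cf c 4 * e1 p + cf c 5 * e2 p).
Definition comb_shift_y c p := 1 / 2 * (cf c 6 * e2 p + cf c 7 * e1 p).

Definition comb_mult c p :=
  1 / 2 * b * cf c 0 * (e1 p * e1 p) * (4 * b * p ix - 1)
  + 1 / 2 * b * cf c 1 * (e2 p * e2 p) * (4 * b * p iy + 1)
  + 2 * b * cf c 3 * (sqrt (p ix) * sqrt (p iy))
  + 2 * b * cf c 4 * sqrt (p ix) * e1 p - 2 * b * cf c 6 * sqrt (p iy) * e2 p
  + cf c 8.

(* The coefficients of [sum_i c_i v_(i+1)], with [exp (b t) = e1 ^ 2] and
   [exp (- b t) = e2 ^ 2]. *)
Definition comb_coef c : var -> pt -> R := fun k p => vcomp
  (comb_dilation c p * p ix - 2 * (- (1 / 2) * cf c 3) * (sqrt (p ix) * sqrt (p iy))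
   + 2 * comb_shift_x c p * sqrt (p ix))
  (comb_dilation c p * p iy + 2 * (- (1 / 2) * cf c 3) * (sqrt (p ix) * sqrt (p iy))
   + 2 * comb_shift_y c p * sqrt (p iy))
  (cf c 0 * (e1 p * e1 p) + cf c 1 * (e2 p * e2 p) + cf c 2)
  (comb_mult c p * p Dep) k.

Lemma comb_coef_smooth c k : smooth (comb_coef c k).
Proof.
by case: k => [[]|]; rewrite /comb_coef /= /comb_mult /comb_dilation
  /comb_shift_x /comb_shift_y /e1 /e2; Ck_tac.
Qed.

(** A [vfield] has to vanish outside [dom]; as smoothness refers to [dom] alone, the cut-off
    preserves it. *)
Lemma comb_exists c :
  {v : vfield | forall k, eq_dom (vcoef v k) (comb_coef c k)}.
Proof.
have S k : smooth (fun p => if `[< dom p >] then comb_coef c k p else 0).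
  by move=> n; apply: Ck_ext (comb_coef_smooth c k n) => p dp; rewrite asboolT.
have off k p : ~ dom p -> (if `[< dom p >] then comb_coef c k p else 0) = 0.
  by move=> dp; rewrite asboolF.
by exists (VField S off) => k p dp /=; rewrite asboolT.
Qed.

Definition comb c : vfield := sval (comb_exists c).

Lemma combE c k : eq_dom (vcoef (comb c) k) (comb_coef c k).
Proof. exact: svalP (comb_exists c) k. Qed.

Lemma comb_linear : linear comb.
Proof.
move=> m c d; apply: vfieldP => k p dp.
change (vcoef (comb (m *: c + d)%R) k p = m * vcoef (comb c) k p + vcoef (comb d) k p).
rewrite !combE //; case: k => [[]|]; rewrite /comb_coef /= /comb_mult /comb_dilation
  /comb_shift_x /comb_shift_y !cf_lin; ring.
Qed.

HB.instance Definition _ := GRing.isLinear.Build R 'rV[R]_9 vfield _ comb comb_linear.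

Definition gvec (i : 'I_9) : vfield := comb (delta_mx ord0 i).

Lemma e1_sqr p : exp (b * p it) = e1 p * e1 p.
Proof. by rewrite /e1 -exp_plus; congr exp; field. Qed.
Lemma e2_sqr p : exp (- b * p it) = e2 p * e2 p.
Proof. by rewrite /e2 -exp_plus; congr exp; field. Qed.
Lemma e2_inv p : e2 p = / e1 p.
Proof. by rewrite /e1 /e2 -exp_Ropp; congr exp; ring. Qed.
Lemma e1_gt0 p : 0 < e1 p. Proof. exact: exp_pos. Qed.

Lemma cf_delta (i : 'I_9) (j : nat) : (j < 9)%N ->
  cf (delta_mx ord0 i) j = if j == i :> nat then 1 else 0.
Proof.
move=> j9; rewrite /cf mxE eqxx /= -val_eqE /= inordK //.
by case: eqP.
Qed.

Lemma gvecE i k p : dom p -> vcoef (gvec i) k p = gen_coef b i k p.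
Proof.
move=> dp; rewrite combE // /gen_coef e1_sqr e2_sqr.
have -> : exp (- b / 2 * p it) = e2 p by rewrite /e2; congr exp; field.
rewrite -/(e1 p) sqrt_mult; try (by apply: Rlt_le; case: dp).
rewrite /comb_coef /comb_mult /comb_dilation /comb_shift_x /comb_shift_y !cf_delta //.
by case: i => [[|[|[|[|[|[|[|[|[|//]]]]]]]]]] ?; case: k => [[]|] /=; field.
Qed.

End Generators.

(** * The symmetries with mu = 0 are the combinations of the generators *)

Section GeneratorSymmetries.
Variable b : R.
Implicit Types (c d : 'rV[R]_9) (p : pt).
Local Notation comb := (comb b).

Ltac expand_comb :=
  rewrite ?/comb_coef ?/comb_mult ?/comb_dilation ?/comb_shift_x ?/comb_shift_y
    ?/e1 ?/e2 /=.

Ltac fold_exp p :=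
  rewrite /= -?/(e1 b p) -?/(e2 b p).

(** Turns the identities into rational ones: the square roots and [e1] become independent positive
    variables, x and y their squares, and [e2] the inverse of [e1]. *)
Ltac comb_field p dp :=
  let s0 := fresh in have s0 := sqrt_x_gt0 dp;
  let r0 := fresh in have r0 := sqrt_y_gt0 dp;
  let E0 := fresh in have E0 := e1_gt0 b p;
  let Ex := fresh in have Ex := sqrt_x_sqr dp;
  let Ey := fresh in have Ey := sqrt_y_sqr dp;
  revert s0 r0 E0 Ex Ey; rewrite ?e2_inv;
  generalize (sqrt (p ix)) (sqrt (p iy)) (e1 b p);
  intros ? ? ? s0 r0 E0 Ex Ey; rewrite ?Ex ?Ey;
  first [lra | field; lra].

Ltac comb_pd p dp := expand_comb; pd_compute; fold_exp p; comb_field p dp.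

Lemma time_only_comb_dilation c : time_only (comb_dilation b c).
Proof.
split=> [|p dp]; first by expand_comb; Ck_tac.
by split; comb_pd p dp.
Qed.

Lemma time_only_comb_shift_x c : time_only (comb_shift_x b c).
Proof.
split=> [|p dp]; first by expand_comb; Ck_tac.
by split; comb_pd p dp.
Qed.

Lemma time_only_comb_shift_y c : time_only (comb_shift_y b c).
Proof.
split=> [|p dp]; first by expand_comb; Ck_tac.
by split; comb_pd p dp.
Qed.

Lemma time_only_cst (m : R) : time_only (fun=> m).
Proof. by split=> [|p dp]; [Ck_tac | split; pd_compute]. Qed.

Lemma comb_xi_pd c p : dom p -> let s := sqrt (p ix) in let r := sqrt (p iy) in
  let f := vcoef (comb c) ix in
  [/\ pd ix f p = comb_dilation b c p + 1 / 2 * cf c 3 * r / s + comb_shift_x b c p / s,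
      pd iy f p = 1 / 2 * cf c 3 * s / r,
      pd it f p = b * b * (cf c 0 * (e1 b p * e1 b p) + cf c 1 * (e2 b p * e2 b p)) * s * s
         + b * (1 / 2 * (cf c 4 * e1 b p - cf c 5 * e2 b p)) * s,
      pd Dep f p = 0 &
      pd ix (pd ix f) p = (- (1 / 2) * cf c 3 * r - comb_shift_x b c p) / (2 * s * s * s) /\
      pd iy (pd iy f) p = (- (1 / 2) * cf c 3) * s / (2 * r * r * r)].
Proof.
move=> dp s r f.
have /= [-> -> -> -> ->] := form_pd_x (time_only_comb_dilation c) (time_only_cst (- (1 / 2) * cf c 3))
  (time_only_comb_shift_x c) (@combE b c ix) dp.
have s0 := sqrt_x_gt0 dp; have r0 := sqrt_y_gt0 dp.
split=> //; try by rewrite /s /r; field; lra.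
- have -> : pd it (fun=> - (1 / 2) * cf c 3) p = 0 by pd_compute.
  have -> : pd it (comb_dilation b c) p =
    b * b * (cf c 0 * (e1 b p * e1 b p) + cf c 1 * (e2 b p * e2 b p)).
    by comb_pd p dp.
  have -> : pd it (comb_shift_x b c) p = b / 2 * (1 / 2 * (cf c 4 * e1 b p - cf c 5 * e2 b p)).
    by comb_pd p dp.
  by rewrite /s; field.
- rewrite /f (pd_ext Dep (@combE b c ix) dp).
  by comb_pd p dp.
Qed.

Lemma comb_ga_pd c p : dom p -> let s := sqrt (p ix) in let r := sqrt (p iy) in
  let f := vcoef (comb c) iy in
  [/\ pd iy f p = comb_dilation b c p - 1 / 2 * cf c 3 * s / r + comb_shift_y b c p / r,
      pd ix f p = - (1 / 2) * cf c 3 * r / s,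
      pd it f p = b * b * (cf c 0 * (e1 b p * e1 b p) + cf c 1 * (e2 b p * e2 b p)) * r * r
         + b * (1 / 2 * (cf c 7 * e1 b p - cf c 6 * e2 b p)) * r,
      pd Dep f p = 0 &
      pd iy (pd iy f) p = (1 / 2 * cf c 3 * s - comb_shift_y b c p) / (2 * r * r * r) /\
      pd ix (pd ix f) p = (1 / 2 * cf c 3) * r / (2 * s * s * s)].
Proof.
move=> dp s r f.
have /= [-> -> -> -> ->] := form_pd_y (time_only_comb_dilation c) (time_only_cst (- (1 / 2) * cf c 3))
  (time_only_comb_shift_y c) (@combE b c iy) dp.
have s0 := sqrt_x_gt0 dp; have r0 := sqrt_y_gt0 dp.
split=> //; try by rewrite /s /r; field; lra.
- have -> : pd it (fun=> - (1 / 2) * cf c 3) p = 0 by pd_compute.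
  have -> : pd it (comb_dilation b c) p =
    b * b * (cf c 0 * (e1 b p * e1 b p) + cf c 1 * (e2 b p * e2 b p)).
    by comb_pd p dp.
  have -> : pd it (comb_shift_y b c) p = b / 2 * (1 / 2 * (cf c 7 * e1 b p - cf c 6 * e2 b p)).
    by comb_pd p dp.
  by rewrite /r; field.
- rewrite /f (pd_ext Dep (@combE b c iy) dp).
  by comb_pd p dp.
- by split; rewrite /s /r; field; lra.
Qed.

Lemma comb_tau_pd c p : dom p -> let f := vcoef (comb c) it in
  [/\ pd ix f p = 0, pd iy f p = 0, pd it f p = comb_dilation b c p & pd Dep f p = 0].
Proof.
move=> dp f; rewrite /f !(pd_ext _ (@combE b c it) dp).
by split; comb_pd p dp.
Qed.

Definition comb_mult_x c p :=
  2 * b * b * cf c 0 * (e1 b p * e1 b p)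
  + (b * cf c 3 * sqrt (p iy) + b * cf c 4 * e1 b p) * / sqrt (p ix).

Definition comb_mult_y c p :=
  2 * b * b * cf c 1 * (e2 b p * e2 b p)
  + (b * cf c 3 * sqrt (p ix) - b * cf c 6 * e2 b p) * / sqrt (p iy).

Lemma comb_phi_pd c p : dom p -> let f := vcoef (comb c) Dep in
  let s := sqrt (p ix) in let r := sqrt (p iy) in
  let E1 := e1 b p * e1 b p in let E2 := e2 b p * e2 b p in
  [/\ pd Dep f p = comb_mult b c p, pd ix f p = comb_mult_x c p * p Dep,
      pd iy f p = comb_mult_y c p * p Dep &
      pd it f p = (1 / 2 * b * b * (cf c 0 * E1 * (4 * b * s * s - 1)
                     - cf c 1 * E2 * (4 * b * r * r + 1))
                   + b * b * (cf c 4 * s * e1 b p + cf c 6 * r * e2 b p)) * p Dep].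
Proof.
move=> dp f s r E1 E2; rewrite /f /s /r /E1 /E2 !(pd_ext _ (@combE b c Dep) dp).
by rewrite /comb_mult_x /comb_mult_y; split; comb_pd p dp.
Qed.

Lemma comb_phi_pd2 c p : dom p -> let f := vcoef (comb c) Dep in
  let s := sqrt (p ix) in let r := sqrt (p iy) in
  [/\ pd Dep (pd Dep f) p = 0, pd ix (pd Dep f) p = comb_mult_x c p,
      pd iy (pd Dep f) p = comb_mult_y c p,
      pd ix (pd ix f) p =
        - (b * cf c 3 * r + b * cf c 4 * e1 b p) / (2 * s * s * s) * p Dep &
      pd iy (pd iy f) p =
        - (b * cf c 3 * s - b * cf c 6 * e2 b p) / (2 * r * r * r) * p Dep].
Proof.
move=> dp f s r.
have fu : eq_dom (pd Dep f) (comb_mult b c) by move=> q /(comb_phi_pd c) [].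
have fx : eq_dom (pd ix f) (fun q => comb_mult_x c q * q Dep).
  by move=> q /(comb_phi_pd c) [].
have fy : eq_dom (pd iy f) (fun q => comb_mult_y c q * q Dep).
  by move=> q /(comb_phi_pd c) [].
rewrite !(pd_ext _ fu dp) (pd_ext _ fx dp) (pd_ext _ fy dp) /s /r.
by rewrite /comb_mult_x /comb_mult_y; split; comb_pd p dp.
Qed.

Lemma comb_in_L c : in_L (1 / 4) b (1 / 4) (- b) (comb c).
Proof.
split; last first.
  (* [comb_mult] is free of u, so it may be read off at u = 0. *)
  exists (fun x y t => comb_mult b c (pt_of x y t 0)), (fun _ _ _ => 0).
  by split=> // p dp; rewrite combE // Rplus_0_r.
have prj : projectable (comb c).
  move=> p dp; have /= [_ xy _ xu _] := comb_xi_pd c dp.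
  have /= [_ gx _ gu _] := comb_ga_pd c dp; have /= [tx ty _ tu] := comb_tau_pd c dp.
  by split=> //; split=> //; rewrite xy gx; comb_field p dp.
apply/symmetry_determining => //.
  by move=> p dp; have /= [] := comb_phi_pd2 c dp.
move=> p dp; have /= [xx xy xt _ [xxx xyy]] := comb_xi_pd c dp.
have /= [gy gx gt _ [gyy gxx]] := comb_ga_pd c dp.
have /= [_ _ tt _] := comb_tau_pd c dp.
have /= [fu fx fy ft] := comb_phi_pd c dp; have /= [_ fux fuy fxx fyy] := comb_phi_pd2 c dp.
rewrite /determining_x /determining_y /determining_u.
rewrite xx xy xt xxx xyy gx gy gt gxx gyy tt fx fy ft fux fuy fxx fyy !combE //.
rewrite /comb_mult_x /comb_mult_y /comb_coef /= /comb_dilation /comb_shift_x /comb_shift_y.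
by split; comb_field p dp.
Qed.

Lemma in_L_comb (v : vfield) : b <> 0 -> in_L (1 / 4) b (1 / 4) (- b) v ->
  exists c, v = comb c.
Proof.
move=> b0 [sym [lam [mu [phi_lam mu0]]]].
(* [lam] comes without regularity; [l] agrees with it on [dom] and inherits smoothness from [v]. *)
pose l := pd Dep (vcoef v Dep).
have lE p : dom p -> l p = lam (p ix) (p iy) (p it).
  move=> dp; rewrite /l.
  have -> : pd Dep (vcoef v Dep) p =
      pd Dep (fun q : pt => lam (q ix) (q iy) (q it) * q Dep) p.
    apply: pd_ext dp => q dq; have := phi_lam q dq => /= ->.
    by rewrite mu0 ?Rplus_0_r; case: dq.
  rewrite /pd (Derive_ext _ (fun s => lam (p ix) (p iy) (p it) * s)).
    by rewrite Derive_scal Derive_id; ring.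
  by move=> s; rewrite upd_eq !upd_neq.
have phiE p : dom p -> vcoef v Dep p = l p * p Dep.
  move=> dp; rewrite lE //; have := phi_lam p dp => /= ->.
  by rewrite mu0 ?Rplus_0_r; case: dp.
have lu : eq_dom (pd Dep l) (fun=> 0).
  move=> p dp; have -> : pd Dep l p = pd Dep (fun q : pt => lam (q ix) (q iy) (q it)) p.
    by apply: pd_ext dp => q; exact: lE.
  rewrite /pd (Derive_ext _ (fun s => lam (p ix) (p iy) (p it))).
    by rewrite Derive_const.
  by move=> s; rewrite !upd_neq.
have prj := symmetry_projectable sym.
have det := proj1 (symmetry_determining (1 / 4) b (1 / 4) (- b) lu prj) sym.
have ttau : time_only (vcoef v it).
  split=> [|p dp]; first exact: vcoef_smooth.
  by have [[_ _ tu] [tx ty _]] := prj p dp.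
have tT := time_only_pd ttau.
have [|p dp|p dp|k [al [be [[tk tal tbe] H]]]] :=
    @conformal_form (vcoef v ix) (vcoef v iy) (vcoef v it) (vcoef_smooth v ix)
      (vcoef_smooth v iy) ttau.
- by move=> p dp; have [[xu gu _] [_ _ xy]] := prj p dp; split.
- by have [] := det p dp.
- by have [] := det p dp.
have xiE p (dp : dom p) := proj1 (H p dp); have gaE p (dp : dom p) := proj2 (H p dp).
have [c [tc cE]] := multiplier_form det tT tk tal tbe xiE gaE lu.
have ode := multiplier_ode det tT tk tal tbe xiE gaE phiE tc cE.
have kconst := rotation_rate_const det tT tk tal tbe xiE gaE.
have [K kK] := time_only_const tk kconst.
have b20 : b / 2 <> 0 by lra.
have [d1 [d2 dE]] : exists a1 a2, forall p, dom p ->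
    pd it (vcoef v it) p = a1 * exp (b * p it) + a2 * exp (- b * p it).
  by apply: time_only_cosh_ode => // p dp; have [] := ode p dp.
have [a1 [a2 aE]] : exists a1 a2, forall p, dom p ->
    al p = a1 * exp (b / 2 * p it) + a2 * exp (- (b / 2) * p it).
  by apply: time_only_cosh_ode => // p dp; have [] := ode p dp.
have [g1 [g2 gE]] : exists a1 a2, forall p, dom p ->
    be p = a1 * exp (b / 2 * p it) + a2 * exp (- (b / 2) * p it).
  by apply: time_only_cosh_ode => // p dp; have [] := ode p dp.
have Ct : smooth (vcoef v it) by exact: vcoef_smooth.
have Tt p : dom p -> pd it (pd it (vcoef v it)) p =
    b * (d1 * exp (b * p it) - d2 * exp (- b * p it)).
  by move=> dp; rewrite (pd_ext it dE dp); pd_compute; rewrite /=; ring.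
have at_ p : dom p -> pd it al p =
    b / 2 * (a1 * exp (b / 2 * p it) - a2 * exp (- (b / 2) * p it)).
  by move=> dp; rewrite (pd_ext it aE dp); pd_compute; rewrite /=; field.
have gt_ p : dom p -> pd it be p =
    b / 2 * (g1 * exp (b / 2 * p it) - g2 * exp (- (b / 2) * p it)).
  by move=> dp; rewrite (pd_ext it gE dp); pd_compute; rewrite /=; field.
(* tau - tau''/b^2 is constant by tau''' = b^2 tau'; this gives the coefficient of v_3. *)
have [|p dp|t0 tE] := @time_only_const (fun p => 1 * vcoef v it p +
    - / (b * b) * pd it (pd it (vcoef v it)) p).
- exact: time_only_lin (time_only_pd tT).
- pd_compute; have [_ T3 _ _] := ode p dp.
  have -> : pd it (pd it (pd it (vcoef v it))) p = b * b * pd it (vcoef v it) p.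
    exact: T3.
  by rewrite /=; field.
have Cc : smooth c by case: tc.
(* The equation c' = -tau''/2 integrates to c = m0 - tau'/2; [m0] is the coefficient of v_9. *)
have [|p dp|m0 mE] := @time_only_const (fun p => 1 * c p + 1 / 2 * pd it (vcoef v it) p).
- exact: time_only_lin.
- by pd_compute; have [-> _ _ _] := ode p dp; rewrite /=; field.
(* Obtained by matching tau', k, al and be with the combination; [g2] precedes [g1] because v_7
   carries the decaying exponent -b/2 and v_8 the exponent b/2. *)
exists (row_of_seq [:: d1 / b; - d2 / b; t0; - 2 * K; 2 * a1; 2 * a2; 2 * g2; 2 * g1; m0]).
apply: vfieldP => i p dp; rewrite combE //.
have cp : c p = m0 - 1 / 2 * pd it (vcoef v it) p by have := mE p dp; lra.
have tp : vcoef v it p = t0 + / (b * b) * pd it (pd it (vcoef v it)) p.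
  by have := tE p dp; lra.
rewrite /comb_coef /comb_mult /comb_dilation /comb_shift_x /comb_shift_y !cf_row_of_seq //.
case: i => [[]|] /=.
- rewrite xiE // dE // kK // aE // e1_sqr e2_sqr -/(e1 b p) -/(e2 b p).
  by field.
- rewrite gaE // dE // kK // gE // e1_sqr e2_sqr -/(e1 b p) -/(e2 b p).
  by field.
- rewrite tp Tt // e1_sqr e2_sqr; by field.
- rewrite phiE // /l cE // cp /multiplier_part Tt // dE // kK // at_ // gt_ // aE // gE //.
  rewrite e1_sqr e2_sqr -/(e1 b p) -/(e2 b p).
  by field.
Qed.

End GeneratorSymmetries.

(** * Structure constants and independence of the generators *)

Section LieStructure.
Variable b : R.
Implicit Types (c d : 'rV[R]_9) (p : pt).
Local Notation comb := (comb b).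

(** The minor [x i j] is the weight of the bracket of v_(i+1) and v_(j+1). The first three entries
    use indices 0 to 2 only and every later one an index at least 3: hence both the ideal and the
    complementary subalgebra. *)
Definition bracket_coord c d : 'rV[R]_9 :=
  let x (i j : nat) := cf c i * cf d j - cf d i * cf c j in
  row_of_seq [:: b * x 2%N 0%N; b * x 1%N 2%N; 2 * b * x 1%N 0%N; 0;
    b / 2 * (x 2%N 4%N - 2 * x 0%N 5%N) + 1 / 2 * x 7%N 3%N;
    b / 2 * (2 * x 1%N 4%N - x 2%N 5%N) + 1 / 2 * x 6%N 3%N;
    b / 2 * (2 * x 1%N 7%N - x 2%N 6%N) - 1 / 2 * x 5%N 3%N;
    b / 2 * (x 2%N 7%N - 2 * x 0%N 6%N) - 1 / 2 * x 4%N 3%N;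
    b * x 5%N 4%N - b * x 7%N 6%N].

Lemma comb_bracket c d : ⁅comb c, comb d⁆ = comb (bracket_coord c d).
Proof.
apply: vfieldP => k p dp; rewrite combE //.
change (vf_bracket_coef (comb c) (comb d) k p = comb_coef b (bracket_coord c d) k p).
have s0 := sqrt_x_gt0 dp; have r0 := sqrt_y_gt0 dp; have E0 := e1_gt0 b p.
have Ex := sqrt_x_sqr dp; have Ey := sqrt_y_sqr dp.
rewrite /vf_bracket_coef /sumv !combE //.
have /= [cxx cxy cxt cxu _] := comb_xi_pd b c dp.
have /= [dxx dxy dxt dxu _] := comb_xi_pd b d dp.
have /= [cyy cyx cyt cyu _] := comb_ga_pd b c dp.
have /= [dyy dyx dyt dyu _] := comb_ga_pd b d dp.
have /= [ctx cty ctt ctu] := comb_tau_pd b c dp.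
have /= [dtx dty dtt dtu] := comb_tau_pd b d dp.
have /= [cu cx cy ct] := comb_phi_pd b c dp.
have /= [du dx dy dt] := comb_phi_pd b d dp.
rewrite /comb_coef /comb_mult /comb_dilation /comb_shift_x /comb_shift_y /bracket_coord !cf_row_of_seq //.
case: k => [[]|] /=.
- rewrite cxx cxy cxt cxu dxx dxy dxt dxu /comb_dilation /comb_shift_x.
  move: s0 r0 E0 Ex Ey; rewrite !e2_inv.
  generalize (sqrt (p ix)) (sqrt (p iy)) (e1 b p) => s r E1 s0 r0 E0 Ex Ey.
  by rewrite Ex Ey; field; lra.
- rewrite cyy cyx cyt cyu dyy dyx dyt dyu /comb_dilation /comb_shift_y.
  move: s0 r0 E0 Ex Ey; rewrite !e2_inv.
  generalize (sqrt (p ix)) (sqrt (p iy)) (e1 b p) => s r E1 s0 r0 E0 Ex Ey.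
  by rewrite Ex Ey; field; lra.
- rewrite ctx cty ctt ctu dtx dty dtt dtu /comb_dilation.
  rewrite !e2_inv.
  by field; lra.
- rewrite cu cx cy ct du dx dy dt /comb_mult /comb_mult_x /comb_mult_y.
  move: s0 r0 E0 Ex Ey; rewrite !e2_inv.
  generalize (sqrt (p ix)) (sqrt (p iy)) (e1 b p) => s r E1 s0 r0 E0 Ex Ey.
  by rewrite Ex Ey; field; lra.
Qed.

Hypothesis b0 : b <> 0.

Lemma comb_inj0 c : comb c = 0%R -> c = 0%R.
Proof.
move=> c0.
have H k p : dom p -> comb_coef b c k p = 0 by move=> dp; rewrite -combE // c0.
(* At t = 0 and u = 1 the exponentials are 1, and squares in place of x and y remove the roots: the
   components become polynomials. *)
have P x y : 0 < x -> 0 < y ->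
  [/\ comb_coef b c ix (pt_of (x * x) (y * y) 0 1) = 0,
      comb_coef b c iy (pt_of (x * x) (y * y) 0 1) = 0,
      comb_coef b c it (pt_of (x * x) (y * y) 0 1) = 0 &
      comb_coef b c Dep (pt_of (x * x) (y * y) 0 1) = 0].
  by move=> x0 y0; split; apply: H; apply: dom_pt_of; nra.
have {}P x y : 0 < x -> 0 < y ->
  [/\ b * (cf c 0 - cf c 1) * (x * x) + cf c 3 * (x * y) + (cf c 4 + cf c 5) * x = 0,
      b * (cf c 0 - cf c 1) * (y * y) - cf c 3 * (x * y) + (cf c 6 + cf c 7) * y = 0,
      cf c 0 + cf c 1 + cf c 2 = 0 &
      2 * (b * b * cf c 0) * (x * x) + 2 * (b * b * cf c 1) * (y * y)
      + 2 * (b * cf c 3) * (x * y) + 2 * (b * cf c 4) * x - 2 * (b * cf c 6) * y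
      + (cf c 8 + 1 / 2 * (b * cf c 1) - 1 / 2 * (b * cf c 0)) = 0].
  move=> x0 y0; have := P x y x0 y0.
  rewrite /comb_coef /comb_mult /comb_dilation /comb_shift_x /comb_shift_y /e1 /e2.
  rewrite /pt_of /= !Rmult_0_r exp_0 !sqrt_square; try lra.
  by case=> h1 h2 h3 h4; split; lra.
have h1 : 0 < 1 by lra. have h2 : 0 < 2 by lra. have h3 : 0 < 3 by lra.
(* The u-component has degree two in the two roots; a triangular grid of six points determines its
   six coefficients. *)
have [X11 Y11 T11 U11] := P _ _ h1 h1; have [_ _ _ U21] := P _ _ h2 h1.
have [_ _ _ U31] := P _ _ h3 h1; have [_ _ _ U12] := P _ _ h1 h2.
have [_ _ _ U13] := P _ _ h1 h3; have [_ _ _ U22] := P _ _ h2 h2.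
have cancel m : b * m = 0 -> m = 0 by case/Rmult_integral.
have c00 : cf c 0 = 0 by apply: (cancel _ (cancel _ _)); clear -U11 U21 U31 U12 U13 U22; lra.
have c10 : cf c 1 = 0 by apply: (cancel _ (cancel _ _)); clear -U11 U21 U31 U12 U13 U22; lra.
have c30 : cf c 3 = 0 by apply: cancel; clear -U11 U21 U31 U12 U13 U22; lra.
have c40 : cf c 4 = 0 by apply: cancel; clear -U11 U21 U31 U12 U13 U22; lra.
have c60 : cf c 6 = 0 by apply: cancel; clear -U11 U21 U31 U12 U13 U22; lra.
(* The x-, y- and t-components now yield the entries 5, 7 and 2, and the u-component the entry 8. *)
rewrite c00 c10 c30 c40 c60 in X11 Y11 T11 U11.
apply: cf_inj => i i9; have -> : cf 0%R i = 0 by rewrite /cf mxE.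
by move: i i9 => [|[|[|[|[|[|[|[|[|//]]]]]]]]] _; rewrite ?c00 //; lra.
Qed.
End LieStructure.

(** * The symmetry algebra *)

Section SymmetryAlgebra.
Variable b : R.
Hypothesis b0 : b <> 0.
Implicit Types (c d : 'rV[R]_9).

Definition sym_mem : {pred vfield} := fun w => `[< in_L (1 / 4) b (1 / 4) (- b) w >].

Lemma sym_memP w : reflect (exists c, w = comb b c) (w \in sym_mem).
Proof.
apply: (iffP idP) => [/asboolP|[c ->]]; first exact: in_L_comb.
by apply/asboolP; exact: comb_in_L.
Qed.

Lemma comb_sym_mem c : comb b c \in sym_mem.
Proof. by apply/sym_memP; exists c. Qed.

Fact sym_submod : submod_closed sym_mem.
Proof.
split=> [|m v w /sym_memP [c ->] /sym_memP [d ->]].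
  by rewrite -(linear0 (comb b)) comb_sym_mem.
by rewrite -linearP comb_sym_mem.
Qed.

Fact sym_lie : {in sym_mem &, forall v w, ⁅v, w⁆ \in sym_mem}.
Proof.
by move=> v w /sym_memP [c ->] /sym_memP [d ->]; rewrite comb_bracket comb_sym_mem.
Qed.

Definition sym_alg : lieSubalg vfield := LieSubalg sym_submod sym_lie.

Definition combL c : sym_alg := Sub (comb b c) (comb_sym_mem c).

Fact combL_linear : linear combL.
Proof. by move=> m c d; apply/val_inj; rewrite /= linearP. Qed.

HB.instance Definition _ := GRing.isLinear.Build R 'rV[R]_9 sym_alg _ combL combL_linear.

Lemma combL_lie c d : ⁅combL c, combL d⁆ = combL (bracket_coord b c d).
Proof. by apply/val_inj; rewrite /= comb_bracket. Qed.

Lemma combL_inj : injective combL.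
Proof.
apply: raddf_inj => c c0; apply: (comb_inj0 b0).
by have := congr1 val c0.
Qed.

Lemma combL_surj (w : sym_alg) : exists c, w = combL c.
Proof.
have /sym_memP [c wc] := valP w; exists c; exact: val_inj.
Qed.

Definition gvecL (i : 'I_9) : sym_alg := combL (delta_mx ord0 i).

Lemma combL_sum c : combL c = (\sum_i c ord0 i *: gvecL i)%R.
Proof.
rewrite {1}[c]row_sum_delta linear_sum; apply: eq_bigr => i _.
by rewrite linearZ.
Qed.

Lemma gvecL_basis : lin_basis gvecL.
Proof.
split=> [a a0 i|w].
  have : combL (\row_i a i) = combL 0.
    rewrite linear0 -[RHS]a0 combL_sum; apply: eq_bigr => j _; by rewrite mxE.
  by move/combL_inj/rowP/(_ i); rewrite !mxE.
have [c ->] := combL_surj w; exists (c ord0); exact: combL_sum.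
Qed.

(** * The ideal of symmetries with vanishing tau-component *)

Definition low_zero c := [/\ cf c 0 = 0, cf c 1 = 0 & cf c 2 = 0].

Definition sym_ideal_mem : {pred sym_alg} := fun w => `[< exists2 c, low_zero c & w = combL c >].

Lemma sym_ideal_memP w : reflect (exists2 c, low_zero c & w = combL c) (w \in sym_ideal_mem).
Proof. exact: asboolP. Qed.

Lemma combL_ideal c : combL c \in sym_ideal_mem <-> low_zero c.
Proof. by split=> [/sym_ideal_memP [d d0 /combL_inj ->]|c0] //; apply/sym_ideal_memP; exists c. Qed.

Fact sym_ideal_submod : submod_closed sym_ideal_mem.
Proof.
split=> [|m v w /sym_ideal_memP [c [c0 c1 c2] ->] /sym_ideal_memP [d [d0 d1 d2] ->]].
  by apply/sym_ideal_memP; exists 0%R; [split; rewrite /cf mxE | rewrite linear0].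
rewrite -linearP; apply/combL_ideal; split; rewrite cf_lin ?c0 ?d0 ?c1 ?d1 ?c2 ?d2; ring.
Qed.

(** The first three entries of [bracket_coord] are minors in the first three coordinates, so they
    vanish with those of [d]. *)
Fact sym_ideal_lie (v : sym_alg) : {in sym_ideal_mem, forall w, ⁅v, w⁆ \in sym_ideal_mem}.
Proof.
have [c ->] := combL_surj v => w /sym_ideal_memP [d [d0 d1 d2] ->].
rewrite combL_lie; apply/combL_ideal.
by split; rewrite /bracket_coord cf_row_of_seq //= ?d0 ?d1 ?d2; ring.
Qed.

Definition sym_ideal : lieIdeal sym_alg := LieIdeal sym_ideal_submod sym_ideal_lie.

(** The splitting 9 = 3 + 6 turns the three conditions into a zero block, which fits the indexing of
    v_4, ..., v_9 by [rshift 3]. *)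
Lemma low_zeroP c : low_zero c <-> exists a : 'rV[R]_6, c = row_mx (0 : 'rV[R]_3)%R a.
Proof.
have cfE (d : 'rV[R]_(3 + 6)) (i : 'I_3) : cf d i = d ord0 (lshift 6 i).
  by congr (d _ _); apply: val_inj; rewrite /= inordK // (leq_trans (ltn_ord i)).
split=> [[c0 c1 c2]|[a ->]].
  exists (rsubmx (c : 'rV_(3 + 6))); rewrite -{1}[c](@hsubmxK _ _ 3 6).
  suff -> : lsubmx (c : 'rV_(3 + 6)) = 0%R by [].
  apply/rowP => i; rewrite !mxE -cfE.
  by case: i => [[|[|[|//]]] ?].
by split; [have := cfE (row_mx 0 a) (inord 0)%R | have := cfE (row_mx 0 a) (inord 1)%R
  | have := cfE (row_mx 0 a) (inord 2)%R]; rewrite inordK // row_mxEl mxE.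
Qed.

Definition gvecJ (k : 'I_6) : sym_alg := gvecL (rshift 3 k).

Lemma combL_row_mx (a : 'rV[R]_6) :
  combL (row_mx (0 : 'rV[R]_3) a)%R = (\sum_k a ord0 k *: gvecJ k)%R.
Proof.
rewrite combL_sum (@big_split_ord _ _ _ 3 6) /= big1 ?add0r.
  by apply: eq_bigr => k _; congr (_ *: _)%R; exact: row_mxEr.
move=> i _; rewrite -[RHS](scale0r (gvecL (lshift 6 i))); congr (_ *: _)%R.
by apply: etrans (row_mxEl _ _ _ _) _; rewrite mxE.
Qed.

Lemma sym_ideal_span (w : sym_alg) : w \in sym_ideal <-> lin_span gvecJ w.
Proof.
split=> [/sym_ideal_memP [c /low_zeroP [a ->] ->]|[a ->]].
  by exists (a ord0); exact: combL_row_mx.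
apply/sym_ideal_memP; exists (row_mx (0 : 'rV[R]_3) (\row_k a k))%R; first by apply/low_zeroP; eexists.
by rewrite combL_row_mx; apply: eq_bigr => k _; rewrite mxE.
Qed.

Lemma gvecJ_mem k : gvecJ k \in sym_ideal.
Proof.
apply/sym_ideal_span; exists (fun j => (j == k)%:R)%R.
rewrite (bigD1 k) //= eqxx scale1r big1 ?addr0 // => j /negPf ->.
by rewrite scale0r.
Qed.

Lemma sym_ideal_dim : has_dim sym_ideal 6.
Proof.
exists (fun k => Sub (gvecJ k) (gvecJ_mem k) : sym_ideal).
have valS (a : 'I_6 -> R) :
    val (\sum_k a k *: (Sub (gvecJ k) (gvecJ_mem k) : sym_ideal))%R = (\sum_k a k *: gvecJ k)%R.
  by rewrite raddf_sum; apply: eq_bigr.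
split=> [a a0 i|w].
  have : combL (row_mx (0 : 'rV_3) (\row_k a k))%R = combL 0%R.
    rewrite linear0 combL_row_mx -[RHS](congr1 val a0) valS.
    by apply: eq_bigr => k _; rewrite mxE.
  move/combL_inj/rowP/(_ (rshift 3 i)); rewrite [RHS]mxE => <-.
  by apply/esym; apply: etrans (row_mxEr _ _ _ _) _; rewrite mxE.
have [a wa] := proj1 (sym_ideal_span (val w)) (valP w).
by exists a; apply/val_inj; rewrite valS.
Qed.

(** * The complementary copy of sl_2 *)

Lemma sum_2 (F : 'I_2 -> R) : (\sum_i F i)%R = F ord0 + F ord_max.
Proof.
rewrite !big_ord_recr big_ord0 /= add0r; congr (F _ + _); exact: val_inj.
Qed.

Lemma mxtrace_2 (M : 'M[R]_2) : (\tr M)%R = M ord0 ord0 + M ord_max ord_max.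
Proof. exact: sum_2. Qed.

(* [[v3, v1] = b v1], [[v3, v2] = - b v2] and [[v1, v2] = - 2 b v3], so
   [(v1, (2 / b) v3, - v2 / b^2)] is an sl2-triple. *)
Definition sl2_row (A : sl R 2) : 'rV[R]_9 :=
  let a := val A in
  row_of_seq [:: a ord0 ord_max; - / (b * b) * a ord_max ord0; 2 / b * a ord0 ord0].

Definition sl2_emb (A : sl R 2) : sym_alg := combL (sl2_row A).

Fact sl2_emb_linear : linear sl2_emb.
Proof.
move=> m A B; rewrite /sl2_emb -linearP; congr combL; apply: cf_inj => i i9.
have E j k : val (m *: A + B)%R j k = m * val A j k + val B j k.
  by rewrite /= !mxE.
rewrite cf_lin !cf_row_of_seq //= !E.
by case: i i9 => [|[|[|i]]] _ /=; rewrite ?nth_nil; ring.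
Qed.

HB.instance Definition _ := GRing.isLinear.Build R (sl R 2) sym_alg _ sl2_emb sl2_emb_linear.

Lemma sl2_trace (A : sl R 2) : val A ord_max ord_max = - val A ord0 ord0.
Proof.
have /eqP := valP A; rewrite mxtrace_2; exact: Rplus_opp_r_uniq.
Qed.

(** Once the trace has eliminated the lower right entries, the first three coordinates agree as
    rational expressions and the other six vanish on both sides. *)
Lemma sl2_emb_lie : {morph sl2_emb : A B / ⁅A, B⁆ >-> ⁅A, B⁆}.
Proof.
move=> A B; rewrite /sl2_emb combL_lie; congr combL; apply: cf_inj => i i9.
have trA := sl2_trace A; have trB := sl2_trace B.
have E j k : val ⁅A, B⁆ j k =
   (val A j ord0 * val B ord0 k + val A j ord_max * val B ord_max k)
   - (val B j ord0 * val A ord0 k + val B j ord_max * val A ord_max k).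
  have -> : val ⁅A, B⁆ = (val A *m val B - val B *m val A)%R by [].
  by rewrite !mxE !sum_2.
rewrite /bracket_coord /sl2_row !cf_row_of_seq //= !E trA trB.
move: (val A ord0 ord0) (val A ord0 ord_max) (val A ord_max ord0)
  (val B ord0 ord0) (val B ord0 ord_max) (val B ord_max ord0).
by case: i i9 => [|[|[|[|[|[|[|[|[|//]]]]]]]]] _ /= *; field.
Qed.

(** The first three coordinates are nonzero multiples of three entries of [A], and the trace gives
    the fourth. *)
Lemma sl2_emb_cap A : sl2_emb A \in sym_ideal -> A = 0%R.
Proof.
move/combL_ideal => []; rewrite /sl2_row !cf_row_of_seq //= => a01 a10 a00.
have cancel (m n : R) : m <> 0 -> m * n = 0 -> n = 0 by move=> m0 /Rmult_integral [].
have {}a10 : val A ord_max ord0 = 0.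
  apply: cancel a10; apply/Ropp_neq_0_compat/Rinv_neq_0_compat; nra.
have {}a00 : val A ord0 ord0 = 0.
  by apply: cancel a00; apply: Rmult_integral_contrapositive; split;
    [lra | exact: Rinv_neq_0_compat].
have a11 := sl2_trace A; rewrite a00 Ropp_0 in a11.
apply/val_inj/matrixP => i j; rewrite [RHS]mxE.
have I2 (k : 'I_2) : k = ord0 \/ k = ord_max.
  by case: k => [[|[|//]] ?]; [left | right]; apply: val_inj.
by case: (I2 i) => ->; case: (I2 j) => ->.
Qed.

Lemma sl2_emb_sum w : exists A, (w - sl2_emb A)%R \in sym_ideal.
Proof.
have [c ->] := combL_surj w.
(* Inverts [sl2_row] on the first three coordinates; the last entry is fixed by the trace. *)
pose m (i j : 'I_2) : R :=
  if i == ord0 then (if j == ord0 then b / 2 * cf c 2 else cf c 0)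
  else (if j == ord0 then - (b * b) * cf c 1 else - (b / 2 * cf c 2)).
pose M : 'M[R]_2 := (\matrix_(i, j) m i j)%R.
have trM : M \in sl R 2.
  by apply/eqP; rewrite mxtrace_2 !mxE; exact: Rplus_opp_r.
exists (Sub M trM : sl R 2); rewrite -linearB; apply/combL_ideal.
have cfB d d' i : cf (d - d')%R i = cf d i - cf d' i by rewrite /cf !mxE.
by split; rewrite cfB /sl2_row cf_row_of_seq //= !mxE /m /=; field.
Qed.

End SymmetryAlgebra.

(** * Basis, ideal, quotient and semidirect decomposition *)

Theorem mainTheorem3 (a b d e : R) :
  a = 1 / 4 -> d = 1 / 4 -> b <> 0 -> e = - b ->
  exists L : lieSubalg vfield,
    (forall w : vfield, w \in L <-> in_L a b d e w) /\
    has_dim L 9 /\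
    exists v : 'I_9 -> L,
      (forall i c p, dom p -> vcoef (\val (v i)) c p = gen_coef b i c p) /\
      lin_basis v /\
      exists J : lieIdeal L,
        (forall w : L,
           w \in J <-> lin_span (fun k : 'I_6 => v (rshift 3 k)) w) /\
        has_dim J 6 /\
        lie_isom (lie_quot J) (sl R 2) /\
        exists (rho : lieAction (sl R 2) J) (f : {linear semidirect rho -> L}),
          bijective f /\
          (forall p q, f (lie p q) = lie (f p) (f q)) /\
          (forall j : J, f (0%R, j) = \val j).
Proof.
move=> -> -> b0 ->.
have cap := @sl2_emb_cap b b0; have sum := @sl2_emb_sum b b0; have hom := @sl2_emb_lie b b0.
exists (sym_alg b0); split; first by move=> w; split=> /asboolP.
split; first by exists (gvecL b0); exact: gvecL_basis.
exists (gvecL b0); split; first by move=> i c p dp; exact: gvecE.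
split; first exact: gvecL_basis.
exists (sym_ideal b0); split; first exact: sym_ideal_span.
split; first exact: sym_ideal_dim.
split; first exact: complement_quot hom cap sum.
exists (complement_action (sym_ideal b0) hom), (@complement_sum _ _ _ (sym_ideal b0) _ hom).
split; first exact: complement_sum_bij.
split=> [p q|j]; first exact: complement_sum_lie.
by rewrite /= /complement_sum linear0 add0r.
Qed.
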